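(* Let $\mathbb{U}^d$ be the forcing whose conditions are the elements of $(\omega)^\omega$, ordered by $p\le q$ iff $p\sqsubseteq^*q$. If $\mathcal{D}$ is $\mathbb{U}^d$-generic over $V$, then in $V[\mathcal{D}]$ the set $\mathcal{D}$ is a game-filter, i.e. a game-family (with respect to the game $\mathcal{G}(\mathcal{D})$) such that $X\sqcap Y\in\mathcal{D}$ for all $X,Y\in\mathcal{D}$.
   Context: A partition of $\omega$ is a set of nonempty pairwise disjoint subsets (blocks) of $\omega$ whose union is $\omega$; $(\omega)^\omega$ is the set of partitions with infinitely many blocks. A partial partition is a set of nonempty pairwise disjoint subsets of $\omega$, with domain the union of its blocks; $(\mathbb{N})$ denotes the set of partial partitions whose domain is a natural number $n=\{0,\dots,n-1\}$; for $s\in(\mathbb{N})$, $|s|$ is its number of blocks and $s^*=s\cup\{\{\mathrm{dom}(s)\}\}$. For partial partitions $X_1,X_2$, $X_1\sqsubseteq X_2$ means: for every block $b$ of $X_1$, $b\cap\mathrm{dom}(X_2)$ is a union of sets $b'\cap\mathrm{dom}(X_1)$ with $b'$ a block of $X_2$. $X_1\sqcap X_2$ is the finest partial partition coarser than both with domain $\mathrm{dom}(X_1)\cup\mathrm{dom}(X_2)$; for finite $f$, $\{f\}$ is the partial partition with the single block $f$; $X_1\sqsubseteq^*X_2$ means $X_1\sqcap\{f\}\sqsubseteq X_2$ for some finite $f\subseteq\mathrm{dom}(X_1)$; $X_1\overset{*}{=}X_2$ means $X_1\sqsubseteq^*X_2$, $X_2\sqsubseteq^*X_1$ and equal domains. $p\trianglelefteq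 q$ means every block of $p$ is $b\cap\mathrm{dom}(p)$ for some block $b$ of $q$. For $s\in(\mathbb{N})$, $X\in(\omega)^\omega$ with $s\sqsubseteq X$, $(s,X)^\omega=\{Y\in(\omega)^\omega: s\trianglelefteq Y\wedge Y\sqsubseteq X\}$. Let $\mathcal{F}\subseteq(\omega)^\omega$. $\mathcal{F}$ is non-principal if for every $X\in\mathcal{F}$ there is $Y\in\mathcal{F}$ with $Y\sqsubseteq X$ and not $Y\overset{*}{=}X$; closed under refinement if $X\sqsubseteq Y$ and $X\in\mathcal{F}$ imply $Y\in\mathcal{F}$; closed under finite changes if $X\sqcap s\in\mathcal{F}$ for all $s\in(\mathbb{N})$, $X\in\mathcal{F}$. For $X\in\mathcal{F}$, $s\sqsubseteq X$, the game $\mathcal{G}(\mathcal{F})$ starting with $\langle s,X\rangle$: all partitions $X_i,Y_i$ played must lie in $\mathcal{F}$. Player I plays $X_0\in(s,X)^\omega$; II plays $\langle t_0,Y_0\rangle$ with $Y_0\in(s,X_0)^\omega$, $s\trianglelefteq t_0^*\trianglelefteq Y_0$, $|t_0|=|s|$. For $n\ge1$, I plays $X_n\in(t_{n-1}^*,Y_{n-1})^\omega$ and II plays $\langle t_n,Y_n\rangle$ with $Y_n\in(t_{n-1}^*,X_n)^\omega$, $t_{n-1}^*\trianglelefteq t_n^*\trianglelefteq Y_n$, $|t_n|=|t_{n-1}|+1$. Player I wins iff the unique partition $Y$ with $t_n\trianglelefteq Y$ for all $n$ belongs to $\mathcal{F}$. $\mathcal{F}$ is a game-family if it is non-principal, closed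 under refinement and under finite changes, and player II has no winning strategy in $\mathcal{G}(\mathcal{F})$. *)

(* Defs.v *)
From mathcomp Require Import all_boot.
From mathcomp Require Import boolp classical_sets functions cardinality.

Set Implicit Arguments.
Unset Strict Implicit.
Unset Printing Implicit Defensive.

Local Open Scope classical_set_scope.

(** Formulas of the language of set theory with parameters from [U], in
    higher-order abstract syntax.  The formulas used below are all uniform in
    [U], i.e. they are ordinary first-order formulas. *)

Inductive fm (U : Type) : Type :=
| Mem of U & U
| Eql of U & U
| Neg of fm U
| And of fm U & fm U
| All of (U -> fm U).

Definition Or U (a b : fm U) := Neg (And (Neg a) (Neg b)).
Definition Imp U (a b : fm U) := Neg (And a (Neg b)).
Definition Iff U (a b : fm U) := And (Imp a b) (Imp b a).
Definition Ex U (f : U -> fm U) := Neg (All (fun x => Neg (f x))).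

Declare Scope fm_scope.
Delimit Scope fm_scope with fm.
Bind Scope fm_scope with fm.

Notation "x ∈ y" := (Mem x y) (at level 70, no associativity) : fm_scope.
Notation "x ≐ y" := (Eql x y) (at level 70, no associativity) : fm_scope.
Notation "¬ a" := (Neg a) (at level 75, right associativity) : fm_scope.
Notation "a ∧ b" := (And a b) (at level 80, right associativity) : fm_scope.
Notation "a ∨ b" := (Or a b) (at level 85, right associativity) : fm_scope.
Notation "a ⇒ b" := (Imp a b) (at level 99, b at level 200) : fm_scope.
Notation "a ⇔ b" := (Iff a b) (at level 95, no associativity) : fm_scope.
Notation "∀ x .. y , a" := (All (fun x => .. (All (fun y => a%fm)) ..))
  (at level 200, x binder, y binder, right associativity) : fm_scope.
Notation "∃ x .. y , a" := (Ex (fun x => .. (Ex (fun y => a%fm)) ..))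
  (at level 200, x binder, y binder, right associativity) : fm_scope.

(** Names and the forcing relation for a preorder [(P, le)], where [le p q]
    means that [p] is stronger than [q].  [Name A n c] is the [P]-name
    [{(n i, c i) : i in A}]. *)

Inductive name (P : Type) : Type :=
| Name (A : Type) (n : A -> name P) (c : A -> P).

Definition dense_below P (le : P -> P -> Prop) (p : P) (A : P -> Prop) : Prop :=
  forall q, le q p -> exists2 r, le r q & A r.

Fixpoint forces_eq P (le : P -> P -> Prop) (x y : name P) (p : P) {struct x} :
    Prop :=
  match x, y with
  | Name A n c, Name B m d =>
    (forall i, dense_below le p (fun q => le q (c i) ->
       exists j, le q (d j) /\ forces_eq le (n i) (m j) q)) /\
    (forall j, dense_below le p (fun q => le q (d j) ->
       exists i, le q (c i) /\ forces_eq le (n i) (m j) q))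
  end.

Definition forces_mem P (le : P -> P -> Prop) (x y : name P) (p : P) : Prop :=
  match y with
  | Name B m d =>
    dense_below le p (fun q => exists j, le q (d j) /\ forces_eq le x (m j) q)
  end.

Fixpoint forces P (le : P -> P -> Prop) (p : P) (a : fm (name P)) : Prop :=
  match a with
  | Mem x y => forces_mem le x y p
  | Eql x y => forces_eq le x y p
  | Neg b => forall q, le q p -> ~ forces le q b
  | And b c => forces le p b /\ forces le p c
  | All f => forall x, forces le p (f x)
  end.

(** Ground-model sets.  In [check] each element carries every condition, so
    that no largest condition is needed. *)

Inductive vset : Type := VSet (A : Type) (e : A -> vset).

Fixpoint check P (x : vset) : name P :=
  match x with
  | VSet A e => Name (fun ip : A * P => check P (e ip.1)) (fun ip => ip.2)
  end.

Definition vempty : vset := VSet (fun x : void => match x with end).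
Definition vsucc (x : vset) : vset :=
  match x with VSet A e => VSet (fun o : option A => oapp e x o) end.
Definition vnat (n : nat) : vset := iter n vsucc vempty.
Definition vset_of T (f : T -> vset) (A : set T) : vset :=
  VSet (fun x : {x : T | A x} => f (sval x)).
Definition vfamily (X : set (set nat)) : vset := vset_of (vset_of vnat) X.

(** [code p] is the set that the condition [p] is; the result is the canonical
    name [{(p^, p) : p in P}] of the generic filter. *)
Definition generic_name P (code : P -> vset) : name P :=
  Name (fun p => check P (code p)) id.

(** The forcing [U^d], in the ground model. *)

Definition pdom (X : set (set nat)) : set nat := \bigcup_(b in X) b.

Definition partial_partition (X : set (set nat)) : Prop :=
  (forall b, X b -> b !=set0) /\
  (forall b c, X b -> X c -> b `&` c !=set0 -> b = c).

Definition inf_partition (X : set (set nat)) : Prop :=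
  [/\ partial_partition X, pdom X = setT & infinite_set X].

Definition coarser (X Y : set (set nat)) : Prop :=
  forall b, X b -> exists2 C, C `<=` Y &
    b `&` pdom Y = \bigcup_(c in C) (c `&` pdom X).

Definition common_coarsening (Z X Y : set (set nat)) : Prop :=
  [/\ partial_partition Z, pdom Z = pdom X `|` pdom Y, coarser Z X &
      coarser Z Y].

Definition is_meet (Z X Y : set (set nat)) : Prop :=
  common_coarsening Z X Y /\
  (forall Z', common_coarsening Z' X Y -> coarser Z' Z).

Definition coarser_ae (X Y : set (set nat)) : Prop :=
  exists f : set nat, [/\ finite_set f, f `<=` pdom X &
    exists2 Z, is_meet Z X [set f] & coarser Z Y].

Definition Ud : Type := {X : set (set nat) | inf_partition X}.
Definition Ud_le (p q : Ud) : Prop := coarser_ae (sval p) (sval q).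
Definition Ud_generic : name Ud := generic_name (fun p : Ud => vfamily (sval p)).

(** Set-theoretic vocabulary as formulas.  [fis_xxx z ...] says that [z] is
    the object described. *)

Local Open Scope fm_scope.

Definition fempty U (x : U) := ∀ z, ¬ z ∈ x.
Definition fsubset U (x y : U) := ∀ z, z ∈ x ⇒ z ∈ y.
Definition fis_upair U (z x y : U) := ∀ u, u ∈ z ⇔ (u ≐ x ∨ u ≐ y).
Definition fis_singleton U (z x : U) := ∀ u, u ∈ z ⇔ u ≐ x.
Definition fis_pair U (z x y : U) :=
  ∃ a b, fis_singleton a x ∧ fis_upair b x y ∧ fis_upair z a b.
Definition fis_succ U (y x : U) := ∀ u, u ∈ y ⇔ (u ∈ x ∨ u ≐ x).

Definition finductive U (w : U) :=
  (∃ e, fempty e ∧ e ∈ w) ∧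
  (∀ n, n ∈ w ⇒ ∃ m, fis_succ m n ∧ m ∈ w).
Definition fis_omega U (w : U) :=
  finductive w ∧ (∀ v, finductive v ⇒ fsubset w v).

Definition fgraph U (f x y : U) := ∃ z, fis_pair z x y ∧ z ∈ f.

(** [f] is a function from the class [A] into the class [B]. *)
Definition ffun_from_to U (f : U) (A B : U -> fm U) :=
  (∀ z, z ∈ f ⇒ ∃ x y, fis_pair z x y ∧ A x ∧ B y) ∧
  (∀ x, A x ⇒ ∃ y, fgraph f x y) ∧
  (∀ x y y', fgraph f x y ⇒ fgraph f x y' ⇒ y ≐ y').

(** "phi holds of f(x)" *)
Definition fat U (f x : U) (phi : U -> fm U) := ∃ y, fgraph f x y ∧ phi y.

Definition fequinumerous U (x k : U) :=
  ∃ f, ffun_from_to f (fun i => i ∈ k) (fun b => b ∈ x) ∧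
    (∀ i j b, fgraph f i b ⇒ fgraph f j b ⇒ i ≐ j) ∧
    (∀ b, b ∈ x ⇒ ∃ i, fgraph f i b).

(** In the rest of the file the parameter [w] stands for omega. *)

Definition ffinite U (w x : U) := ∃ k, k ∈ w ∧ fequinumerous x k.

Definition fin_pdom U (n X : U) := ∃ b, b ∈ X ∧ n ∈ b.

Definition fpartial_partition U (w X : U) :=
  (∀ b, b ∈ X ⇒ fsubset b w ∧ ∃ n, n ∈ b) ∧
  (∀ b c, b ∈ X ⇒ c ∈ X ⇒ (∃ n, n ∈ b ∧ n ∈ c) ⇒ b ≐ c).

Definition fpartition U (w X : U) :=
  fpartial_partition w X ∧ (∀ n, n ∈ w ⇒ fin_pdom n X).

Definition finf_partition U (w X : U) := fpartition w X ∧ ¬ ffinite w X.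

Definition fcoarser U (X Y : U) :=
  ∀ b, b ∈ X ⇒ ∃ C, fsubset C Y ∧
    ∀ n, (n ∈ b ∧ fin_pdom n Y) ⇔ (∃ c, c ∈ C ∧ n ∈ c ∧ fin_pdom n X).

Definition fcommon_coarsening U (w Z X Y : U) :=
  fpartial_partition w Z ∧
  (∀ n, fin_pdom n Z ⇔ (fin_pdom n X ∨ fin_pdom n Y)) ∧
  fcoarser Z X ∧ fcoarser Z Y.

Definition fis_meet U (w Z X Y : U) :=
  fcommon_coarsening w Z X Y ∧
  (∀ Z', fcommon_coarsening w Z' X Y ⇒ fcoarser Z' Z).

Definition fcoarser_ae U (w X Y : U) :=
  ∃ f, ffinite w f ∧ (∀ n, n ∈ f ⇒ fin_pdom n X) ∧
    ∃ F Z, fis_singleton F f ∧ fis_meet w Z X F ∧ fcoarser Z Y.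

Definition feq_ae U (w X Y : U) :=
  fcoarser_ae w X Y ∧ fcoarser_ae w Y X ∧ (∀ n, fin_pdom n X ⇔ fin_pdom n Y).

Definition fsegment U (p q : U) :=
  ∀ b, b ∈ p ⇒ ∃ c, c ∈ q ∧ ∀ n, n ∈ b ⇔ (n ∈ c ∧ fin_pdom n p).

Definition fpdom_is U (s k : U) := ∀ n, fin_pdom n s ⇔ n ∈ k.

(** [s] belongs to (N). *)
Definition ffin_partition U (w s : U) :=
  fpartial_partition w s ∧ ∃ k, k ∈ w ∧ fpdom_is s k.

Definition fis_star U (u s : U) :=
  ∃ k b, fpdom_is s k ∧ fis_singleton b k ∧ ∀ c, c ∈ u ⇔ (c ∈ s ∨ c ≐ b).

(** "phi holds of s*" *)
Definition fstar U (s : U) (phi : U -> fm U) := ∃ u, fis_star u s ∧ phi u.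

(** [Y] belongs to (s, X)^omega. *)
Definition fellentuck U (w s X Y : U) :=
  finf_partition w Y ∧ fsegment s Y ∧ fcoarser Y X.

(** |t| = |s| and |t| = |s| + 1, for finite [s] *)
Definition fsame_size U (w t s : U) :=
  ∃ k, k ∈ w ∧ fequinumerous s k ∧ fequinumerous t k.
Definition fsucc_size U (w t s : U) :=
  ∃ k l, k ∈ w ∧ fis_succ l k ∧ fequinumerous s k ∧ fequinumerous t l.

(** The game for [F] starting with [<s, X>].  An infinite sequence of moves is
    given by functions [x], [t], [y] on omega: player I plays [x n] and
    player II answers [<t n, y n>]. *)

Definition flegalI U (w s X x t y n : U) :=
  (fempty n ⇒ fat x n (fun xn => fellentuck w s X xn)) ∧
  (∀ m, m ∈ w ⇒ fis_succ n m ⇒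
     fat x n (fun xn => fat t m (fun tm => fat y m (fun ym =>
       fstar tm (fun tm' => fellentuck w tm' ym xn))))).

Definition flegalII U (w s x t y n : U) :=
  fat x n (fun xn => fat t n (fun tn => fat y n (fun yn =>
  fstar tn (fun tn' =>
    fsegment tn' yn ∧
    (fempty n ⇒
       fellentuck w s xn yn ∧ fsegment s tn' ∧ fsame_size w tn s) ∧
    (∀ m, m ∈ w ⇒ fis_succ n m ⇒
       fat t m (fun tm => fstar tm (fun tm' =>
         fellentuck w tm' xn yn ∧ fsegment tm' tn' ∧
         fsucc_size w tn tm))))))).

(** Player I wins the run with first components [t] of player II's moves:
    in a legal run the domains of the [t n] exhaust omega, so [Y] is unique. *)
Definition fI_wins U (w F t : U) :=
  ∃ Y, fpartition w Y ∧ (∀ n, n ∈ w ⇒ fat t n (fun tn => fsegment tn Y)) ∧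
    Y ∈ F.

(** A strategy for player II maps each finite sequence (X_0, ..., X_n) of
    elements of [F] to a pair in (N) x F.  It is total, legality being required
    of its answers only after legal moves of player I. *)
Definition fstrategyII U (w F sigma : U) :=
  ffun_from_to sigma
    (fun h => ∃ n i, n ∈ w ∧ fis_succ i n ∧
       ffun_from_to h (fun j => j ∈ i) (fun Z => Z ∈ F))
    (fun v => ∃ t y, fis_pair v t y ∧ ffin_partition w t ∧ y ∈ F).

(** <t n, y n> = sigma (x restricted to n + 1) *)
Definition ffollows U (F sigma x t y n : U) :=
  ∃ i h v, fis_succ i n ∧
    ffun_from_to h (fun j => j ∈ i) (fun Z => Z ∈ F) ∧ fsubset h x ∧
    fat t n (fun tn => fat y n (fun yn => fis_pair v tn yn)) ∧
    fgraph sigma h v.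

Definition fwinningII U (w F s X sigma : U) :=
  fstrategyII w F sigma ∧
  ∀ x t y,
    ffun_from_to x (fun n => n ∈ w) (fun Z => Z ∈ F) ⇒
    ffun_from_to t (fun n => n ∈ w) (fun u => ffin_partition w u) ⇒
    ffun_from_to y (fun n => n ∈ w) (fun Z => Z ∈ F) ⇒
    (∀ n, n ∈ w ⇒ ffollows F sigma x t y n) ⇒
    (∀ n, n ∈ w ⇒ (∀ m, (m ∈ n ∨ m ≐ n) ⇒ flegalI w s X x t y m) ⇒
       flegalII w s x t y n) ∧
    ((∀ n, n ∈ w ⇒ flegalI w s X x t y n) ⇒ ¬ fI_wins w F t).

Definition fnonprincipal U (w F : U) :=
  ∀ X, X ∈ F ⇒ ∃ Y, Y ∈ F ∧ fcoarser Y X ∧ ¬ feq_ae w Y X.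

Definition frefinement_closed U (w F : U) :=
  ∀ X Y, X ∈ F ⇒ finf_partition w Y ⇒ fcoarser X Y ⇒ Y ∈ F.

Definition ffinite_change_closed U (w F : U) :=
  ∀ X s, X ∈ F ⇒ ffin_partition w s ⇒ ∃ Z, fis_meet w Z X s ∧ Z ∈ F.

Definition fgame_family U (w F : U) :=
  (∀ X, X ∈ F ⇒ finf_partition w X) ∧
  fnonprincipal w F ∧ frefinement_closed w F ∧ ffinite_change_closed w F ∧
  (∀ s X, X ∈ F ⇒ ffin_partition w s ⇒ fcoarser s X ⇒
     ¬ ∃ sigma, fwinningII w F s X sigma).

Definition fgame_filter U (F : U) :=
  ∃ w, fis_omega w ∧ fgame_family w F ∧
    (∀ X Y, X ∈ F ⇒ Y ∈ F ⇒ ∃ Z, fis_meet w Z X Y ∧ Z ∈ F).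

(* Main.v *)
(** A condition is an equivalence relation on the naturals with infinitely many
    classes.  If [R_0 ⊆ R_1 ⊆ ...] are such relations, [R_(n+1)] agrees with
    [R_n] on [{0, ..., d_n}], and [d_n] is the least element of its [R_n]-class,
    then the union of the [R_n] is a condition below all of them (fusion).
    Moreover a condition [r] below [p] is equivalent to a condition coarser than
    [p] with a prescribed trace on an initial segment (amalgamation).  Hence the
    forcing is countably closed, it adds no partitions, and statements about
    partitions are absolute; the closure properties of the generic filter are
    then density arguments.

    If [sigma] is forced to be a winning strategy for player II, let player I
    play conditions [X_0 >= X_1 >= ...] such that [X_(n+1)] decides the answer
    [<t_n, Y_n>] to [X_0, ..., X_n] and lies in [(t_n^*, Y_n)^omega]; this is
    possible by amalgamation.  The fusion [Y] of the [Y_n] is below every [X_n]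
    and every [Y_n] and has all [t_n] as initial segments.  So [Y] forces that
    [Y] is in the generic filter and that player I wins this run. *)

From mathcomp Require Import all_boot.
From mathcomp Require Import boolp classical_sets functions cardinality.
Require Import Defs.

Set Implicit Arguments.
Unset Strict Implicit.
Unset Printing Implicit Defensive.

Local Open Scope classical_set_scope.
Local Open Scope card_scope.

Set Maximal Implicit Insertion.

(** * Forcing calculus *)

(** Winning constrains complete runs only, so a strategy for player II is not known to answer a
    position legally before the run is finished. The run is therefore built with its claims
    conditional on legality. Any lower bound of its conditions forces the answers to be legal;
    legality of a run of ground model objects is absolute, so it holds outright and can be reused at
    the fusion, which need not be related to that lower bound. A second obstacle is that the order
    holds modulo finite sets: the relations along a descending sequence need not increase, and even
    an increasing union may have finitely many classes. Amalgamation replaces each condition by an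
    equivalent one that extends the previous relation and keeps its trace on an initial segment;
    this is the input of fusion. Objects of the extension are arbitrary names. They are treated by
    passing to a condition that forces them equal to check names, after which equals must be
    substituted in each formula concerned. *)

Record forcing_order (P : Type) := ForcingOrder {
  fo_le :> P -> P -> Prop;
  fo_refl : forall p, fo_le p p;
  fo_trans : forall p q r, fo_le p q -> fo_le q r -> fo_le p r }.
Arguments fo_refl {P f} p.
Arguments fo_trans {P f p q r}.

Section Forcing.
Context {P : Type} {le : forcing_order P}.
Implicit Types (p q r : P) (x y z : name P) (a b : fm (name P)).
Implicit Types f g : name P -> fm (name P).

Local Notation "p ⊩ a" := (forces le p a%fm) (at level 100, a at level 200).

Lemma feq_refl x p : forces_eq le x x p.
Proof.
elim: x p => A n IH c p /=; split => i q qp; exists q; try exact: fo_refl;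
  by move=> qi; exists i; split.
Qed.

Lemma feq_sym x y p : forces_eq le x y p -> forces_eq le y x p.
Proof.
elim: x y p => A n IH c [B m d] p /= [H1 H2]; split => i q qp.
- have [r rq H] := H2 i q qp; exists r => // /H[j [rj e]].
  by exists j; split=> //; apply: IH.
- have [r rq H] := H1 i q qp; exists r => // /H[j [rj e]].
  by exists j; split=> //; apply: IH.
Qed.

Lemma dense_below_mono p q (A : P -> Prop) :
  le q p -> dense_below le p A -> dense_below le q A.
Proof. by move=> qp H r rq; apply: H; apply: fo_trans qp. Qed.

Lemma dense_below_idem p (A : P -> Prop) :
  dense_below le p (fun q => dense_below le q A) -> dense_below le p A.
Proof.
move=> H q qp; have [r rq Hr] := H q qp.
have [s sr As] := Hr r (fo_refl r); exists s => //; exact: fo_trans rq.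
Qed.

Lemma forces_mono p q a : le q p -> (p ⊩ a) -> (q ⊩ a).
Proof.
elim: a p q => [x y|x y|a IH|a IHa b IHb|f IH] p q qp /=.
- by case: y => B m d /=; apply: dense_below_mono.
- case: x => A n c; case: y => B m d /= [H1 H2].
  by split=> i; apply: dense_below_mono; eauto.
- by move=> H r rq; apply: H; apply: fo_trans qp.
- by move=> [Ha Hb]; split; [apply: IHa Ha|apply: IHb Hb].
- by move=> H x; apply: IH (H x).
Qed.

(** The conditions forcing a formula form a regular open set: density is built into the atomic
    clauses, the negation clause turns it into a contradiction, and the other clauses inherit it.
    This is what permits passing to an extension while proving that something is forced. *)
Lemma forces_dense p a : dense_below le p (fun q => q ⊩ a) -> (p ⊩ a).
Proof.
elim: a p => [x y|x y|a IH|a IHa b IHb|f IH] p /=.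
- by case: y => B m d /=; apply: dense_below_idem.
- case: x => A n c; case: y => B m d /= H.
  split=> i; apply: dense_below_idem => q qp; have [r rq []] := H q qp;
    by move=> H1 H2; exists r => //; first [exact: H1|exact: H2].
- move=> H q qp Hq; have [r rq Hr] := H q qp.
  exact: (Hr r (fo_refl r) (forces_mono rq Hq)).
- move=> H; split; [apply: IHa|apply: IHb] => q qp;
    by have [r rq []] := H q qp; exists r.
- move=> H x; apply: IH => q qp; have [r rq Hr] := H q qp.
  by exists r.
Qed.

(** Classical logic inside the forcing relation; it gives the connectives defined by negation their
    positive reading. *)
Lemma forces_contra p a :
  (forall q, le q p -> (q ⊩ ¬ a) -> False) -> (p ⊩ a).
Proof.
move=> H; apply: forces_dense => q qp; apply: contrapT => N.
by apply: (H q qp) => r rq ra; apply: N; exists r.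
Qed.

Lemma forces_and p a b : (p ⊩ a ∧ b) <-> (p ⊩ a) /\ (p ⊩ b).
Proof. by []. Qed.

Lemma forces_memE p x A n c : (p ⊩ x ∈ @Name P A n c) <->
  dense_below le p (fun q => exists i, le q (c i) /\ (q ⊩ x ≐ n i)).
Proof. by []. Qed.

Lemma andI p a b : (p ⊩ a) -> (p ⊩ b) -> (p ⊩ a ∧ b).
Proof. by []. Qed.

Lemma andD p a b : (p ⊩ a ∧ b) -> (p ⊩ a) /\ (p ⊩ b).
Proof. by []. Qed.

Lemma allI p f : (forall x, p ⊩ f x) -> (p ⊩ All f).
Proof. by []. Qed.

Lemma allE p f x : (p ⊩ All f) -> (p ⊩ f x).
Proof. exact. Qed.

Lemma negI p a : (forall q, le q p -> (q ⊩ a) -> False) -> (p ⊩ ¬ a).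
Proof. by []. Qed.

Lemma forces_ex p f :
  (p ⊩ Ex f) <-> dense_below le p (fun q => exists x, q ⊩ f x).
Proof.
split=> [H q qp|H q qp /= N].
- apply: contrapT => N; apply: (H q qp) => x r rq rx.
  by apply: N; exists r => //; exists x.
- by have [r rq [x rx]] := H q qp; apply: (N x r rq).
Qed.

Lemma forces_imp p a b :
  (p ⊩ a ⇒ b) <-> (forall q, le q p -> (q ⊩ a) -> (q ⊩ b)).
Proof.
split=> [H q qp Ha|H q qp /= [Ha Nb]].
- apply: forces_contra => r rq Nb.
  by apply: (H r (fo_trans rq qp)); split=> //; apply: forces_mono Ha.
- exact: (Nb q (fo_refl q) (H q qp Ha)).
Qed.

Lemma forces_or p a b :
  (p ⊩ a ∨ b) <-> dense_below le p (fun q => (q ⊩ a) \/ (q ⊩ b)).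
Proof.
split=> [H q qp|H q qp /= [Na Nb]].
- apply: contrapT => N; apply: (H q qp); split=> r rq ?;
    by apply: N; exists r => //; auto.
- by have [r rq [] ?] := H q qp; [apply: Na rq _|apply: Nb rq _].
Qed.

Lemma exI p f x : (p ⊩ f x) -> (p ⊩ Ex f).
Proof.
move=> H; apply/forces_ex => q qp; exists q; first exact: fo_refl.
by exists x; apply: forces_mono H.
Qed.

Lemma exD p f : (p ⊩ Ex f) -> exists x q, le q p /\ (q ⊩ f x).
Proof.
by move/forces_ex/(_ p (fo_refl p)) => [q qp [x H]]; exists x, q.
Qed.

Lemma exE p f b :
  (p ⊩ Ex f) -> (forall q x, le q p -> (q ⊩ f x) -> (q ⊩ b)) -> (p ⊩ b).
Proof.
move=> /forces_ex H K; apply: forces_dense => q qp.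
have [r rq [x rx]] := H q qp; exists r => //.
by apply: K rx; apply: fo_trans qp.
Qed.

Lemma impI p a b :
  (forall q, le q p -> (q ⊩ a) -> (q ⊩ b)) -> (p ⊩ a ⇒ b).
Proof. by move/forces_imp. Qed.

Lemma impE p a b : (p ⊩ a ⇒ b) -> (p ⊩ a) -> (p ⊩ b).
Proof. by move/forces_imp => H; apply: H; apply: fo_refl. Qed.

Lemma orIl p a b : (p ⊩ a) -> (p ⊩ a ∨ b).
Proof.
move=> H; apply/forces_or => q qp; exists q; first exact: fo_refl.
by left; apply: forces_mono H.
Qed.

Lemma orIr p a b : (p ⊩ b) -> (p ⊩ a ∨ b).
Proof.
move=> H; apply/forces_or => q qp; exists q; first exact: fo_refl.
by right; apply: forces_mono H.
Qed.

Lemma orD p a b : (p ⊩ a ∨ b) -> exists q, le q p /\ ((q ⊩ a) \/ (q ⊩ b)).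
Proof. by move/forces_or/(_ p (fo_refl p)) => [q qp H]; exists q. Qed.

Lemma orE p a b c :
  (p ⊩ a ∨ b) -> (forall q, le q p -> (q ⊩ a) -> (q ⊩ c)) ->
  (forall q, le q p -> (q ⊩ b) -> (q ⊩ c)) -> (p ⊩ c).
Proof.
move=> /forces_or H Ka Kb; apply: forces_dense => q qp.
have [r rq [] Hr] := H q qp; exists r => //.
- by apply: Ka Hr; apply: fo_trans qp.
- by apply: Kb Hr; apply: fo_trans qp.
Qed.

Lemma forces_iff p a b :
  (p ⊩ a ⇔ b) <-> (forall q, le q p -> (q ⊩ a) <-> (q ⊩ b)).
Proof.
split=> [[/forces_imp H1 /forces_imp H2] q qp|H].
- by split; [apply: H1|apply: H2].
- by split; apply/forces_imp => q qp /(H q qp).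
Qed.

Lemma iffL p a b : (p ⊩ a ⇔ b) -> (p ⊩ a) -> (p ⊩ b).
Proof. by move/forces_iff/(_ p (fo_refl p)) => ->. Qed.

Lemma iffR p a b : (p ⊩ a ⇔ b) -> (p ⊩ b) -> (p ⊩ a).
Proof. by move/forces_iff/(_ p (fo_refl p)) => ->. Qed.

Lemma negD p a : (p ⊩ ¬ a) -> (p ⊩ a) -> False.
Proof. by move=> H; apply: H; apply: fo_refl. Qed.

Lemma forces_eq_refl p x : p ⊩ x ≐ x.
Proof. exact: feq_refl. Qed.

Lemma forces_eq_sym p x y : (p ⊩ x ≐ y) -> (p ⊩ y ≐ x).
Proof. exact: feq_sym. Qed.

Lemma forces_eq_trans p x y z : (p ⊩ x ≐ y) -> (p ⊩ y ≐ z) -> (p ⊩ x ≐ z).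
Proof.
elim: x y z p => A n IH c [B m d] [C k e] p /= [H1 H2] [K1 K2].
split=> i; apply: dense_below_idem => q qp.
- have [r rq Hr] := H1 i q qp; exists r => // r' r'r.
  have [s sr Hs] := H1 i r' (fo_trans r'r (fo_trans rq qp)).
  (* Either some extension of [s] lies below [c i], and witnesses are followed below it through [y]
     to [z], or the implication to be made dense is vacuous at [s]. *)
  have [si|N] := pselect (exists2 s', le s' s & le s' (c i)).
  + have [s' s's s'c] := si.
    have s'p : le s' p.
      exact: fo_trans s's (fo_trans sr (fo_trans r'r (fo_trans rq qp))).
    have [u us' Hu] := H1 i s' s'p.
    have [j [uj ej]] := Hu (fo_trans us' s'c).
    have [v vu Hv] := K1 j u (fo_trans us' s'p).
    have [l [vl el]] := Hv (fo_trans vu uj).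
    exists v; first by apply: fo_trans (fo_trans us' (fo_trans s's sr)).
    move=> _; exists l; split=> //; apply: IH el.
    exact: (@forces_mono _ _ (Eql _ _) vu ej).
  + exists s => // sc; case: N; exists s => //; exact: fo_refl.
- exists q => [|r rq]; first exact: fo_refl.
  have [sc|N] := pselect (exists2 s, le s r & le s (e i)).
  + have [s sr sc'] := sc; have sp : le s p.
      exact: fo_trans sr (fo_trans rq qp).
    have [u us Hu] := K2 i s sp.
    have [j [uj ej]] := Hu (fo_trans us sc').
    have [v vu Hv] := H2 j u (fo_trans us sp).
    have [l [vl el]] := Hv (fo_trans vu uj).
    exists v; first exact: fo_trans vu (fo_trans us sr).
    move=> _; exists l; split=> //; apply: IH el _.
    exact: (@forces_mono _ _ (Eql _ _) vu ej).
  + exists r => [|rc]; first exact: fo_refl.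
    case: N; exists r => //; exact: fo_refl.
Qed.

Lemma mem_congl p x x' y : (p ⊩ x ≐ x') -> (p ⊩ x ∈ y) -> (p ⊩ x' ∈ y).
Proof.
case: y => B m d e H q qp; have [r rq [j [rj ej]]] := H q qp.
exists r => //; exists j; split=> //.
apply: (@forces_eq_trans _ _ x) ej; apply: forces_eq_sym; apply: forces_mono e.
exact: fo_trans qp.
Qed.

Lemma mem_congr p x y y' : (p ⊩ y ≐ y') -> (p ⊩ x ∈ y) -> (p ⊩ x ∈ y').
Proof.
case: y y' => B m d [B' m' d'] [e _] H q qp.
have [r rq [j [rj ej]]] := H q qp.
have [s sr Hs] := e j r (fo_trans rq qp).
have [l [sl el]] := Hs (fo_trans sr rj).
exists s; first exact: fo_trans rq.
exists l; split=> //; apply: (@forces_eq_trans _ _ (m j)) el.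
exact: (@forces_mono _ _ (Eql _ _) sr ej).
Qed.

(** Forced equality only compares the names occurring in [x] and [y]. Such a name [n i] is forced
    into [x] by every condition below [c i], so the hypothesis applies to it there. *)
Lemma eq_ext p x y :
  (forall q z, le q p -> (q ⊩ z ∈ x) <-> (q ⊩ z ∈ y)) -> (p ⊩ x ≐ y).
Proof.
have main A n c B m d :
    (forall q z, le q p -> (q ⊩ z ∈ @Name _ A n c) -> (q ⊩ z ∈ @Name _ B m d)) ->
    forall i, dense_below le p (fun q => le q (c i) ->
       exists j, le q (d j) /\ forces_eq le (n i) (m j) q).
  move=> H i q qp; have [[r rq rc]|N] := pselect (exists2 r, le r q & le r (c i)).
    have rp : le r p := fo_trans rq qp.
    have Hr : r ⊩ n i ∈ Name n c.
      move=> s sr; exists s; first exact: fo_refl.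
      by exists i; split; [exact: fo_trans rc|exact: feq_refl].
    have [s sr Hs] := H r (n i) rp Hr r (fo_refl r).
    by exists s => //; exact: fo_trans rq.
  exists q => [|qc]; first exact: fo_refl.
  by case: N; exists q => //; exact: fo_refl.
case: x y => A n c [B m d] H; split; first by apply: main => q z /H ->.
move=> j; have H' : forall q z, le q p -> (q ⊩ z ∈ Name m d) -> (q ⊩ z ∈ Name n c).
  by move=> q z /H ->.
move=> q qp; have [r rq Hr] := main _ _ _ _ _ _ H' j q qp.
by exists r => // /Hr [i [ri e]]; exists i; split=> //; apply: feq_sym.
Qed.

(** [All] takes an arbitrary function on names, so substitution of equals cannot be proved once for
    all formulas; it is assembled from congruence rules. Equivalence is required at all [q] below
    [p] so that it passes through negation. *)
Definition feqv p a b := forall q, le q p -> (q ⊩ a) <-> (q ⊩ b).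

Lemma feqv_refl p a : feqv p a a. Proof. by []. Qed.

Lemma feqv_neg p a b : feqv p a b -> feqv p (Neg a) (Neg b).
Proof.
move=> H q qp; split=> N r rq /(H _ (fo_trans rq qp)); exact: N.
Qed.

Lemma feqv_and p a a' b b' :
  feqv p a a' -> feqv p b b' -> feqv p (And a b) (And a' b').
Proof.
by move=> H K q qp; split=> -[/(H _ qp) ? /(K _ qp) ?].
Qed.

Lemma feqv_all p f g : (forall x, feqv p (f x) (g x)) -> feqv p (All f) (All g).
Proof. by move=> H q qp; split=> K x; apply/(H x q qp). Qed.

Lemma feqv_mem p x x' y y' :
  (p ⊩ x ≐ x') -> (p ⊩ y ≐ y') -> feqv p (x ∈ y)%fm (x' ∈ y')%fm.
Proof.
move=> ex ey q qp; have {}ex := forces_mono qp ex; have {}ey := forces_mono qp ey.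
split=> H.
- by apply: mem_congl ex _; apply: mem_congr ey _.
- by apply: mem_congl (forces_eq_sym ex) _; apply: mem_congr (forces_eq_sym ey) _.
Qed.

Lemma feqv_eql p x x' y y' :
  (p ⊩ x ≐ x') -> (p ⊩ y ≐ y') -> feqv p (x ≐ y)%fm (x' ≐ y')%fm.
Proof.
move=> ex ey q qp; have {}ex := forces_mono qp ex; have {}ey := forces_mono qp ey.
split=> H.
- by apply: forces_eq_trans (forces_eq_sym ex) _; apply: forces_eq_trans H ey.
- by apply: forces_eq_trans ex _; apply: forces_eq_trans H (forces_eq_sym ey).
Qed.

Definition fcongr f :=
  forall p x y, (p ⊩ x ≐ y) -> (p ⊩ f x) -> (p ⊩ f y).

Lemma fcongr_feqv f :
  (forall p x y, (p ⊩ x ≐ y) -> feqv p (f x) (f y)) -> fcongr f.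
Proof. by move=> H p x y e; apply: (proj1 (H p x y e p (fo_refl p))). Qed.

Lemma feqvP p a b : feqv p a b -> (p ⊩ a) -> (p ⊩ b).
Proof. by move=> H; apply: (proj1 (H p (fo_refl p))). Qed.

End Forcing.

Arguments fcongr {P} le f.
Arguments allE {P le p f} x.
Global Opaque forces.

(** Proves that two formulas that differ only by names forced to be equal are
    equivalent. *)
Ltac feqv_solve :=
  lazymatch goal with
  | |- feqv _ ?a ?a => exact: feqv_refl
  | |- @feqv ?P ?le ?p ?a ?b =>
    let a' := eval hnf in a in let b' := eval hnf in b in
    change_no_check (@feqv P le p a' b');
    lazymatch a' with
    | And _ _ => apply: feqv_and; feqv_solve
    | Neg _ => apply: feqv_neg; feqv_solve
    | All _ => apply: feqv_all => ?; feqv_solve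
    | Mem _ _ => apply: feqv_mem; feqv_solve
    | Eql _ _ => apply: feqv_eql; feqv_solve
    end
  | |- _ => first [ assumption | exact: forces_eq_refl
                  | apply: forces_eq_sym; assumption ]
  end.

Ltac fcongr_solve := apply: fcongr_feqv => ? ? ? ?; feqv_solve.


(** * Absoluteness for ground model objects *)

(** All that is known at [p] is moved to the stronger [q], so that a proof works at a single current
    condition. *)
Ltac weaken Hq :=
  lazymatch type of Hq with
  | fo_le ?le ?q ?p =>
    repeat match goal with
    | H : forces _ p _ |- _ => apply (forces_mono Hq) in H
    | H : fo_le _ p _ |- _ => apply (fo_trans Hq) in H
    end
  end.

(** If the goal is forced at the same condition, density lets the proof continue below it; for any
    other goal one extension with a witness is picked. *)
Ltac fex H x :=
  let q := fresh "q" in let Hq := fresh "Hq" in let H' := fresh in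
  lazymatch type of H with
  | forces ?le ?p _ =>
    lazymatch goal with
    | |- forces le p _ => refine (exE H _); intros q x Hq H'
    | |- _ => destruct (exD H) as [x [q [Hq H']]]
    end; clear H; weaken Hq; rename H' into H
  end.

Ltac fcase H :=
  let q := fresh "q" in let Hq := fresh "Hq" in let H' := fresh in
  lazymatch type of H with
  | forces ?le ?p _ =>
    lazymatch goal with
    | |- forces le p _ => refine (orE H _ _); intros q Hq H'
    | |- _ => destruct (orD H) as [q [Hq [H'|H']]]
    end; clear H; weaken Hq; rename H' into H
  end.

Ltac fimp H :=
  let q := fresh "q" in let Hq := fresh "Hq" in
  apply: impI => q Hq H; weaken Hq.

Ltac fiff H :=
  let q := fresh "q" in let Hq := fresh "Hq" in
  apply/forces_iff => q Hq; weaken Hq; split=> H.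

Section Absoluteness.
Context {P : Type} {le : forcing_order P}.
Implicit Types (p q r : P) (x y z : name P) (a b : fm (name P)).
Implicit Types phi psi : name P -> fm (name P).

Local Notation "p ⊩ a" := (forces le p a%fm) (at level 100, a at level 200).
Local Notation "x ^" := (check P x) (at level 2, format "x ^").

(** [Q] does not depend on the condition. Hence a fact forced by any extension, however chosen, is
    true and is forced everywhere. *)
Definition absolute a (Q : Prop) := forall p, (p ⊩ a) <-> Q.

Lemma abs_and a b Q R :
  absolute a Q -> absolute b R -> absolute (And a b) (Q /\ R).
Proof. by move=> H K p; rewrite forces_and; split=> -[/(H p) ? /(K p)]. Qed.

Lemma abs_imp a b Q R :
  absolute a Q -> absolute b R -> absolute (Imp a b) (Q -> R).
Proof.
move=> H K p; rewrite forces_imp; split=> [F /(H p)|F q _ /H /F /K //].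
by move=> /(F p (fo_refl p)) /K.
Qed.

Lemma abs_or a b Q R :
  absolute a Q -> absolute b R -> absolute (Or a b) (Q \/ R).
Proof.
move=> H K p; split=> [/orD [q [_ [/(H q)|/(K q)]]]|[/(H p)|/(K p)]]; auto.
- exact: orIl.
- exact: orIr.
Qed.

Lemma abs_iff a b Q R :
  absolute a Q -> absolute b R -> absolute (Iff a b) (Q <-> R).
Proof.
move=> H K p; have HK := abs_imp H K; have KH := abs_imp K H.
rewrite forces_and; split=> -[]; first by move=> /(HK p) ? /(KH p).
by move=> /(HK p) ? /(KH p).
Qed.

Lemma abs_ex phi (Q : Prop) :
  (forall x p, (p ⊩ phi x) -> Q) -> (Q -> exists x, absolute (phi x) True) ->
  absolute (Ex phi) Q.
Proof.
move=> H K p; split=> [/exD [x [q [_ Hx]]]|/K [x Hx]]; first exact: H Hx.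
by apply: (@exI _ _ _ _ x); apply/Hx.
Qed.

Definition injective_code T (f : T -> vset) :=
  forall s t, absolute ((f s)^ ≐ (f t)^)%fm (s = t).

Section Codes.
Variables (T : Type) (f : T -> vset).
Implicit Types A B : set T.

Lemma mem_code p x A : (p ⊩ x ∈ (vset_of f A)^) <->
  dense_below le p (fun q => exists2 t, A t & q ⊩ x ≐ (f t)^).
Proof.
split=> [/forces_memE H|H]; last apply/forces_memE; move=> q qp;
  have [r rq] := H q qp.
- by move=> [[[t At] s] /= [_ e]]; exists r => //; exists t.
- move=> [t At e]; exists r => //; exists (exist _ t At, r).
  by split=> //; exact: fo_refl.
Qed.

Lemma memI p x A t : A t -> (p ⊩ x ≐ (f t)^) -> (p ⊩ x ∈ (vset_of f A)^).
Proof.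
move=> At e; apply/mem_code => q qp; exists q; first exact: fo_refl.
by exists t => //; exact: forces_mono e.
Qed.

Lemma memD p x A : (p ⊩ x ∈ (vset_of f A)^) ->
  exists t q, [/\ le q p, A t & q ⊩ x ≐ (f t)^].
Proof.
by move/mem_code/(_ p (fo_refl p)) => [q qp [t At e]]; exists t, q.
Qed.

Lemma memE p x A b : (p ⊩ x ∈ (vset_of f A)^) ->
  (forall q t, le q p -> A t -> (q ⊩ x ≐ (f t)^) -> (q ⊩ b)) -> (p ⊩ b).
Proof.
move=> /mem_code H K; apply: forces_dense => q qp.
have [r rq [t At e]] := H q qp; exists r => //.
exact: K (fo_trans rq qp) At e.
Qed.

Lemma mem_sub p x A B : A `<=` B ->
  (p ⊩ x ∈ (vset_of f A)^) -> (p ⊩ x ∈ (vset_of f B)^).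
Proof. by move=> AB H; apply: (memE H) => q t _ /AB; exact: memI. Qed.

Lemma abs_all_in A phi (Q : T -> Prop) : fcongr le phi ->
  (forall t, A t -> absolute (phi (f t)^) (Q t)) ->
  absolute (∀ z, z ∈ (vset_of f A)^ ⇒ phi z)%fm (forall t, A t -> Q t).
Proof.
move=> C H p; split=> [K t At|K]; last apply: allI => z.
  by apply/(H t At p); apply: (impE (allE (f t)^ K)); exact: memI At (forces_eq_refl _ _).
apply: impI => q qp Hz; apply: (memE Hz) => r t rq At e.
by apply: C (forces_eq_sym e) _; apply/H => //; exact: K.
Qed.

Lemma abs_ex_in A phi (Q : T -> Prop) : fcongr le phi ->
  (forall t, A t -> absolute (phi (f t)^) (Q t)) ->
  absolute (∃ z, z ∈ (vset_of f A)^ ∧ phi z)%fm (exists2 t, A t & Q t).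
Proof.
move=> C H; apply: abs_ex => [x p /andD [/memD [t [q [qp At e]]] K]|[t At Qt]].
  by exists t => //; apply/(H t At q)/(C _ _ _ e); exact: forces_mono K.
exists (f t)^ => p; split=> // _; apply: andI; last exact/H.
exact: memI At (forces_eq_refl _ _).
Qed.

Hypothesis f_inj : injective_code f.

Lemma abs_mem A t : absolute ((f t)^ ∈ (vset_of f A)^)%fm (A t).
Proof.
move=> p; split=> [/memD [s [q [_ As /f_inj ->]]] //|At].
exact: memI At (forces_eq_refl _ _).
Qed.

Lemma abs_nonempty A : absolute (∃ z, z ∈ (vset_of f A)^)%fm (A !=set0).
Proof.
apply: abs_ex => [x p /memD [t [_ [_ At _]]]|[t At]]; first by exists t.
by exists (f t)^ => p; rewrite abs_mem.
Qed.

Lemma abs_subset A B : 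
  absolute (fsubset (vset_of f A)^ (vset_of f B)^) (A `<=` B).
Proof.
apply: abs_all_in => [|t _]; [by fcongr_solve|exact: abs_mem].
Qed.

Lemma injective_code_set : injective_code (vset_of f).
Proof.
move=> A B p; split=> [e|->]; last exact: forces_eq_refl.
rewrite predeqE => t; split=> At.
- by apply/(abs_mem B t p)/(mem_congr e)/abs_mem.
- by apply/(abs_mem A t p)/(mem_congr (forces_eq_sym e))/abs_mem.
Qed.

End Codes.

Lemma mem_vsucc p x v : (p ⊩ x ∈ (vsucc v)^) <-> (p ⊩ x ∈ v^ ∨ x ≐ v^).
Proof.
case: v => A e /=; split=> [/forces_memE H|].
- apply/forces_or => q qp; have [r rq [[[i|] s] [/= rs ei]]] := H q qp.
  + exists r => //; left; apply/forces_memE => u ur; exists u; first exact: fo_refl.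
    by exists (i, u); split; [exact: fo_refl|exact: forces_mono ei].
  + by exists r => //; right.
- move/forces_or => H; apply/forces_memE => q qp.
  have [r rq [/forces_memE H1|H1]] := H q qp.
  + have [s sr [[i u] [/= su ei]]] := H1 r (fo_refl r).
    exists s; first exact: fo_trans rq.
    by exists (Some i, u).
  + exists r => //; exists (None, r); split=> //; exact: fo_refl.
Qed.

(** Numerals are iterated successors; this brings them into the form [vset_of], to which the lemmas
    on codes apply. *)
Lemma mem_vnat p x n : (p ⊩ x ∈ (vnat n)^) <->
  (p ⊩ x ∈ (vset_of vnat `I_n)^).
Proof.
elim: n p => [|n IH] p.
  split=> [/forces_memE/(_ p (fo_refl p)) [r _ [[[]]]]|].
  by move=> /memD [t [q []]].
rewrite [vnat _]/(vsucc (vnat n)) mem_vsucc; split=> H.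
- fcase H.
  + by apply: mem_sub (proj1 (IH _) H) => t /= /ltnW.
  + by apply: memI H => /=.
- apply: (memE H) => q t qp /=; rewrite ltnS leq_eqVlt => /orP[/eqP->|tn] e.
  + exact: orIr.
  + by apply: orIl; apply/IH; apply: memI e.
Qed.

(** Equality would put the numeral [n] into itself and so make it equal to some [i < n]: infinite
    descent. *)
Lemma vnat_lt_neq n m p : n < m -> (p ⊩ (vnat n)^ ≐ (vnat m)^) -> False.
Proof.
elim/ltn_ind: n m p => n IH m p nm e.
have : p ⊩ (vnat n)^ ∈ (vnat n)^.
  apply: mem_congr (forces_eq_sym e) _; apply/mem_vnat.
  by apply: memI (forces_eq_refl _ _).
move/mem_vnat/memD => [i [q [qp /= lt_in e']]].
exact: (IH i lt_in n q lt_in (forces_eq_sym e')).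
Qed.

Lemma injective_vnat : injective_code vnat.
Proof.
move=> n m p; split=> [e|->]; last exact: forces_eq_refl.
case: (ltngtP n m) => // nm; first by case: (vnat_lt_neq nm e).
by case: (vnat_lt_neq nm (forces_eq_sym e)).
Qed.

Lemma injective_vset : injective_code (vset_of vnat).
Proof. exact/injective_code_set/injective_vnat. Qed.

Lemma vnatE p n : p ⊩ (vnat n)^ ≐ (vset_of vnat `I_n)^.
Proof. by apply: eq_ext => q z _; exact: mem_vnat. Qed.

Definition omega : name P := (vset_of vnat setT)^.

Lemma mem_omega p n : p ⊩ (vnat n)^ ∈ omega.
Proof. exact: memI (forces_eq_refl _ _). Qed.


Lemma is_succ_eq p y n :
  (p ⊩ fis_succ y (vnat n)^) <-> (p ⊩ y ≐ (vnat n.+1)^).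
Proof.
have E q z : (q ⊩ z ∈ (vnat n.+1)^) <-> (q ⊩ z ∈ (vnat n)^ ∨ z ≐ (vnat n)^).
  by rewrite [vnat n.+1]/(vsucc _) mem_vsucc.
split=> H.
  apply: eq_ext => q z qp; weaken qp; rewrite E.
  by split; [apply: iffL (allE z H)|apply: iffR (allE z H)].
apply: allI => z; fiff K; first by apply/E/(mem_congr H).
by apply/(mem_congr (forces_eq_sym H))/E.
Qed.

Lemma abs_is_succ n m : absolute (fis_succ (vnat n)^ (vnat m)^) (n = m.+1).
Proof. by move=> p; rewrite is_succ_eq; exact: injective_vnat. Qed.

Lemma empty_eq p x : (p ⊩ fempty x) <-> (p ⊩ x ≐ (vnat 0)^).
Proof.
have N q z : (q ⊩ z ∈ (vnat 0)^) -> False.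
  by move/forces_memE/(_ q (fo_refl q)) => [r _ [[[]]]].
split=> H.
  apply: eq_ext => q z qp; weaken qp; split=> [|/N//].
  by move/(negD (allE z H)).
apply: allI => z; apply: negI => q qp K; weaken qp.
exact: N (mem_congr H K).
Qed.

Lemma abs_empty n : absolute (fempty (vnat n)^) (n = 0).
Proof. by move=> p; rewrite empty_eq; exact: injective_vnat. Qed.

Lemma forces_is_omega p : p ⊩ fis_omega omega.
Proof.
apply: andI.
  apply: andI.
    apply: (@exI _ _ _ _ (vnat 0)^); apply: andI; first exact/abs_empty.
    exact: mem_omega.
  apply: allI => x; fimp H; apply: (memE H) => r n rq _ e.
  apply: (@exI _ _ _ _ (vnat n.+1)^); apply: andI; last exact: mem_omega.
  have: r ⊩ fis_succ (vnat n.+1)^ (vnat n)^ by apply/abs_is_succ.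
  by apply: feqvP; feqv_solve.
apply: allI => v; fimp H; apply: allI => x; fimp Hx.
(* Induction outside the forcing relation suffices, because below a dense set every element of
   [omega] is a check numeral. *)
have [H0 HS] := andD H; have Hn n : q0 ⊩ (vnat n)^ ∈ v.
  elim: n => [|n IH].
    by fex H0 e; have [/empty_eq] := andD H0; exact: mem_congl.
  have K := impE (allE _ HS) IH; fex K y.
  by have [/is_succ_eq] := andD K; exact: mem_congl.
apply: (memE Hx) => r n rq _ e; weaken rq.
by apply: mem_congl (forces_eq_sym e) _; exact: forces_mono (Hn n).
Qed.

End Absoluteness.
Arguments absolute {P} le a Q.
Arguments omega {P}.

(** * Absoluteness of the vocabulary of partitions *)

Definition segment (X Y : set (set nat)) : Prop :=
  forall b, X b -> exists2 c, Y c & forall n, b n <-> c n /\ pdom X n.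

(** This is $s^*$ when [k] is the domain of [s]. *)
Definition star (s : set (set nat)) (k : nat) : set (set nat) :=
  s `|` [set [set k]].

Section PartitionFormulas.
Context {P : Type} {le : forcing_order P}.
Implicit Types (p q r : P) (x y z : name P).
Implicit Types phi psi : name P -> fm (name P).
Implicit Types X Y Z s : set (set nat).

Local Notation "p ⊩ a" := (forces le p a%fm) (at level 100, a at level 200).
Local Notation "x ^" := (check P x) (at level 2, format "x ^").
Local Notation absolute := (absolute le).

Lemma abs_mem_set (A : set nat) n : absolute ((vnat n)^ ∈ (vset_of vnat A)^)%fm (A n).
Proof. by apply: abs_mem; exact: injective_vnat. Qed.

Lemma abs_mem_family X A : absolute ((vset_of vnat A)^ ∈ (vfamily X)^)%fm (X A).
Proof. by apply: abs_mem; exact: injective_vset. Qed.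

Lemma family_memD p x X : (p ⊩ x ∈ (vfamily X)^) ->
  exists A q, [/\ le q p, X A & q ⊩ x ≐ (vset_of vnat A)^].
Proof. exact: memD. Qed.

Lemma family_memE p x X (b : fm (name P)) : (p ⊩ x ∈ (vfamily X)^) ->
  (forall q A, le q p -> X A -> (q ⊩ x ≐ (vset_of vnat A)^) -> (q ⊩ b)) ->
  (p ⊩ b).
Proof. exact: memE. Qed.

Lemma set_mem_omega p x (A : set nat) :
  (p ⊩ x ∈ (vset_of vnat A)^) -> (p ⊩ x ∈ omega).
Proof. exact: mem_sub. Qed.

Lemma pdom_mem_omega p x X : (p ⊩ fin_pdom x (vfamily X)^) -> (p ⊩ x ∈ omega).
Proof.
move=> H; fex H b; have [/family_memE K Hx] := andD H.
apply: K => r A rq _ e; weaken rq; apply: set_mem_omega.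
exact: mem_congr e Hx.
Qed.

Lemma abs_pdom n X : absolute (fin_pdom (vnat n)^ (vfamily X)^) (pdom X n).
Proof.
apply: abs_ex_in => [|A _]; [by fcongr_solve|exact: abs_mem_set].
Qed.

(** The quantifier ranges over all names, but each side forces its argument into [omega], so
    numerals are enough; [fcongr] transports the formulas to them. *)
Lemma abs_all_iff phi psi (Q R : nat -> Prop) :
  fcongr le phi -> fcongr le psi ->
  (forall p x, (p ⊩ phi x) -> p ⊩ x ∈ omega) ->
  (forall p x, (p ⊩ psi x) -> p ⊩ x ∈ omega) ->
  (forall n, absolute (phi (vnat n)^) (Q n)) ->
  (forall n, absolute (psi (vnat n)^) (R n)) ->
  absolute (∀ n, phi n ⇔ psi n)%fm (forall n, Q n <-> R n).
Proof.
move=> C D Hw Kw H K p; split=> [F n|F].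
  by apply/(abs_iff (H n) (K n) p); exact: allE F.
apply: allI => x; fiff G.
- apply: (memE (Hw _ _ G)) => r n rq _ e; weaken rq.
  by apply: D (forces_eq_sym e) _; apply/K/F/H; apply: C G.
- apply: (memE (Kw _ _ G)) => r n rq _ e; weaken rq.
  by apply: C (forces_eq_sym e) _; apply/H/F/K; apply: D G.
Qed.

Lemma abs_partial_partition X :
  absolute (fpartial_partition omega (vfamily X)^) (partial_partition X).
Proof.
apply: abs_and.
  apply: abs_all_in => [|b _]; first by fcongr_solve.
  have -> : (b !=set0) = ((b `<=` setT) /\ (b !=set0)).
    by rewrite propeqE; split=> [|[]].
  apply: abs_and; first  by apply: abs_subset; exact: injective_vnat.
  by apply: abs_nonempty; exact: injective_vnat.
move=> p; split=> [H b c Xb Xc [n [bn cn]]|H].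
  apply/(injective_vset b c p).
  apply: impE (impE (impE (allE _ (allE _ H)) _) _) _; try exact/abs_mem_family.
  by apply: (@exI _ _ _ _ (vnat n)^); apply: andI; exact/abs_mem_set.
apply: allI => b; apply: allI => c; fimp Hb; fimp Hc; fimp K.
apply: (family_memE Hb) => r B rq XB eB; weaken rq.
apply: (family_memE Hc) => r' C rq' XC eC; weaken rq'.
fex K n; have [nb nc] := andD K.
apply: (memE (mem_congr eB nb)) => s m sq Bm em; weaken sq.
have Cm : C m by apply/(abs_mem_set C m s)/(mem_congl em)/(mem_congr eC).
have BC : B = C by apply: H => //; exists m.
by rewrite BC in eB; apply: forces_eq_trans eB (forces_eq_sym eC).
Qed.

Lemma abs_coarser X Y :
  absolute (fcoarser (vfamily X)^ (vfamily Y)^) (coarser X Y).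
Proof.
apply: (@abs_all_in _ _ _ _ _ (fun b => ∃ C, fsubset C (vfamily Y)^ ∧
    ∀ n, (n ∈ b ∧ fin_pdom n (vfamily Y)^) ⇔
         (∃ c, c ∈ C ∧ n ∈ c ∧ fin_pdom n (vfamily X)^))%fm).
  by fcongr_solve.
move=> b Xb.
have E C : absolute (∀ n, (n ∈ (vset_of vnat b)^ ∧ fin_pdom n (vfamily Y)^) ⇔
    (∃ c, c ∈ (vfamily C)^ ∧ n ∈ c ∧ fin_pdom n (vfamily X)^))%fm
    (forall n, (b n /\ pdom Y n) <-> exists2 c, C c & c n /\ pdom X n).
  apply: abs_all_iff; try by fcongr_solve.
  - by move=> p x /andD [_]; exact: pdom_mem_omega.
  - by move=> p x H; fex H c; have [_ /andD [_]] := andD H; exact: pdom_mem_omega.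
  - by move=> n; apply: abs_and; [exact: abs_mem_set|exact: abs_pdom].
  - move=> n; apply: abs_ex_in => [|c _]; first by fcongr_solve.
    by apply: abs_and; [exact: abs_mem_set|exact: abs_pdom].
move=> p; split=> [H|[C CY bE]]; last first.
  apply: (@exI _ _ _ _ (vfamily C)^); apply: andI.
    by apply/abs_subset => //; exact: injective_vset.
  apply/E => n; have /predeqP/(_ n) := bE; rewrite /bigcup /setI /mkset => ->.
  by split=> -[c ? []]; exists c.
fex H C; have [H1 H2] := andD H.
(* The witness [C] is only a name. The largest possible ground model witness replaces it: all blocks
   of [Y] whose trace on the domain of [X] lies in [b]. *)
exists [set c | Y c /\ forall n, c n -> pdom X n -> b n] => [c []//|].
rewrite predeqE => n; split=> [[bn Yn]|[c [Yc cb] [cn Xn]]]; last first.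
  by split; [exact: cb|exists c].
have K : q ⊩ (vnat n)^ ∈ (vset_of vnat b)^ ∧ fin_pdom (vnat n)^ (vfamily Y)^.
  by apply: andI; [exact/abs_mem_set|exact/abs_pdom].
move: (iffL (allE _ H2) K) => {}K; fex K c.
have [cC /andD [nc Xn]] := andD K.
have /family_memD [c0 [r [rq Yc0 e]]] := impE (allE _ H1) cC; weaken rq.
exists c0; last first.
  by split; [apply/(abs_mem_set c0 n r)/(mem_congr e)|apply/(abs_pdom n X r)].
split=> // m cm Xm.
have L : r ⊩ ∃ c, c ∈ C ∧ (vnat m)^ ∈ c ∧ fin_pdom (vnat m)^ (vfamily X)^.
  apply: (@exI _ _ _ _ c); apply: andI => //; apply: andI; last exact/abs_pdom.
  by apply/(mem_congr (forces_eq_sym e))/abs_mem_set.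
by have /andD [/abs_mem_set] := iffR (allE _ H2) L.
Qed.

Lemma abs_segment X Y :
  absolute (fsegment (vfamily X)^ (vfamily Y)^) (segment X Y).
Proof.
rewrite /segment; apply: abs_all_in => [|b Xb]; first by fcongr_solve.
apply: (@abs_ex_in _ _ _ _ _ (fun c => ∀ n, n ∈ (vset_of vnat b)^ ⇔
  (n ∈ c ∧ fin_pdom n (vfamily X)^))%fm); first by fcongr_solve.
move=> c Yc; apply: abs_all_iff; try by fcongr_solve.
- by move=> p x; exact: set_mem_omega.
- by move=> p x /andD [_]; exact: pdom_mem_omega.
- by move=> n; exact: abs_mem_set.
- by move=> n; apply: abs_and; [exact: abs_mem_set|exact: abs_pdom].
Qed.

Lemma is_singletonE p x (A : set nat) :
  (p ⊩ fis_singleton x (vset_of vnat A)^) <-> (p ⊩ x ≐ (vfamily [set A])^).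
Proof.
have E q z : (q ⊩ z ∈ (vfamily [set A])^) <-> (q ⊩ z ≐ (vset_of vnat A)^).
  split=> [H|]; first by apply: (family_memE H) => r B _ ->.
  exact: memI.
split=> H.
  apply: eq_ext => q z qp; weaken qp; rewrite E.
  by split; [apply: iffL (allE z H)|apply: iffR (allE z H)].
apply: allI => z; fiff K; first by apply/E/(mem_congr H).
by apply/(mem_congr (forces_eq_sym H))/E.
Qed.

Lemma is_pdomE p x X k : pdom X = `I_k ->
  (p ⊩ fpdom_is (vfamily X)^ x) <-> (p ⊩ x ≐ (vnat k)^).
Proof.
move=> Xk; have E q z : (q ⊩ z ∈ (vnat k)^) <-> (q ⊩ fin_pdom z (vfamily X)^).
  rewrite mem_vnat -Xk; split=> [H|H].
  - apply: (memE H) => r n rq Xn e.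
    have: r ⊩ fin_pdom (vnat n)^ (vfamily X)^ by apply/abs_pdom.
    by apply: feqvP; feqv_solve.
  - have zw : q ⊩ z ∈ omega by exact: pdom_mem_omega H.
    apply: (memE zw) => r n rq _ e; weaken rq.
    have: r ⊩ fin_pdom (vnat n)^ (vfamily X)^.
      by apply: feqvP H; feqv_solve.
    by move=> /abs_pdom Xn; apply: memI Xn e.
split=> H.
  apply: eq_ext => q z qp; weaken qp; rewrite E.
  by split; [apply: iffR (allE z H)|apply: iffL (allE z H)].
apply: allI => z; fiff K; first by apply/(mem_congr (forces_eq_sym H))/E.
by apply/E/(mem_congr H).
Qed.

Lemma abs_fin_partition X : absolute (ffin_partition omega (vfamily X)^)
  (partial_partition X /\ exists k, pdom X = `I_k).
Proof.
apply: abs_and; first exact: abs_partial_partition.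
apply: abs_ex => [x p /andD [/memD [k [q [qp _ e]]] H]|[k Xk]].
  exists k; weaken qp.
  have {}H : q ⊩ fpdom_is (vfamily X)^ (vnat k)^ by apply: feqvP H; feqv_solve.
  rewrite predeqE => n; split=> [Xn|/= nk].
  - have: q ⊩ fin_pdom (vnat n)^ (vfamily X)^ by apply/abs_pdom.
    by move=> /(iffL (allE _ H))/mem_vnat/abs_mem_set.
  - have: q ⊩ (vnat n)^ ∈ (vnat k)^ by apply/mem_vnat/abs_mem_set.
    by move=> /(iffR (allE _ H))/abs_pdom.
exists (vnat k)^ => p; split=> // _; apply: andI; first exact: mem_omega.
exact/(is_pdomE _ _ Xk)/forces_eq_refl.
Qed.

Lemma star_mem p x X k : (p ⊩ x ∈ (vfamily (star X k))^) <->
  (p ⊩ x ∈ (vfamily X)^ ∨ x ≐ (vset_of vnat [set k])^).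
Proof.
split=> H; last by fcase H; [apply: mem_sub H; left|apply: memI H; right].
apply: (family_memE H) => q A qp [XA e|-> e]; last exact: orIr.
by apply: orIl; apply: memI XA e.
Qed.

Lemma is_starE p x X k : pdom X = `I_k ->
  (p ⊩ fis_star x (vfamily X)^) <-> (p ⊩ x ≐ (vfamily (star X k))^).
Proof.
move=> Xk; split=> H.
  fex H k'; fex H b; have [/(is_pdomE _ _ Xk) ek /andD [Hb Hx]] := andD H.
  have eb : q0 ⊩ b ≐ (vset_of vnat [set k])^.
    apply: eq_ext => r z rq; weaken rq; split=> Hz.
    - apply: (@memI _ _ _ _ _ _ _ k) => //.
      by apply: forces_eq_trans ek; apply: iffL (allE _ Hb) Hz.
    - apply: iffR (allE _ Hb) _; apply: (memE Hz) => s n sr -> e; weaken sr.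
      by apply: forces_eq_trans e (forces_eq_sym ek).
  apply: eq_ext => r z rq; weaken rq; rewrite star_mem; split=> Hz.
  - have := iffL (allE _ Hx) Hz; apply: feqvP; feqv_solve.
  - apply: iffR (allE _ Hx) _; apply: feqvP Hz; feqv_solve.
apply: (@exI _ _ _ _ (vnat k)^); apply: (@exI _ _ _ _ (vset_of vnat [set k])^).
apply: andI; first exact/(is_pdomE _ _ Xk)/forces_eq_refl.
apply: andI.
  apply: allI => z; fiff Hz; last exact: memI Hz.
  by apply: (memE Hz) => r n rq ->.
apply: allI => z; fiff Hz.
- by apply/star_mem; apply: mem_congr H Hz.
- by apply: mem_congr (forces_eq_sym H) _; apply/star_mem.
Qed.

Lemma fstarI p phi X k : pdom X = `I_k ->
  (p ⊩ phi (vfamily (star X k))^) -> (p ⊩ fstar (vfamily X)^ phi).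
Proof.
move=> Xk H; apply: (@exI _ _ _ _ (vfamily (star X k))^); apply: andI => //.
exact/(is_starE _ _ Xk)/forces_eq_refl.
Qed.

Lemma fstarD p phi X k : pdom X = `I_k -> (p ⊩ fstar (vfamily X)^ phi) ->
  fcongr le phi -> (p ⊩ phi (vfamily (star X k))^).
Proof.
by move=> Xk H C; fex H u; have [/(is_starE _ _ Xk) e] := andD H; exact: C.
Qed.

End PartitionFormulas.

(** * Names for pairs and functions *)

Section Pairs.
Context {P : Type} {le : forcing_order P}.
Implicit Types (p q r : P) (x y z u v : name P).
Implicit Types phi psi : name P -> fm (name P).

Local Notation "p ⊩ a" := (forces le p a%fm) (at level 100, a at level 200).
Local Notation "x ^" := (check P x) (at level 2, format "x ^").
Local Notation absolute := (absolute le).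

(** As in [check], each element carries every condition, which does without a largest condition. *)
Definition upair x y : name P :=
  Name (fun ip : bool * P => if ip.1 then x else y) (fun ip => ip.2).

Definition opair x y : name P := upair (upair x x) (upair x y).

Lemma mem_upair p z x y : (p ⊩ z ∈ upair x y) <-> (p ⊩ z ≐ x ∨ z ≐ y).
Proof.
rewrite forces_memE forces_or; split=> H q qp; have [r rq] := H q qp.
- by move=> [[[] s] /= [_ e]]; exists r => //; [left|right].
- by move=> [e|e]; exists r => //; [exists (true, r)|exists (false, r)];
    split=> //; exact: fo_refl.
Qed.

Lemma mem_single p z x : (p ⊩ z ∈ upair x x) <-> (p ⊩ z ≐ x).
Proof. by rewrite mem_upair; split=> [H|]; [fcase H|exact: orIl]. Qed.

Lemma is_upairE p z x y : (p ⊩ fis_upair z x y) <-> (p ⊩ z ≐ upair x y).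
Proof.
split=> H.
  apply: eq_ext => q u qp; weaken qp; rewrite mem_upair.
  by split; [apply: iffL (allE u H)|apply: iffR (allE u H)].
apply: allI => u; fiff K; first by apply/mem_upair/(mem_congr H).
by apply/(mem_congr (forces_eq_sym H))/mem_upair.
Qed.

Lemma is_singleE p z x : (p ⊩ fis_singleton z x) <-> (p ⊩ z ≐ upair x x).
Proof.
split=> H.
  apply: eq_ext => q u qp; weaken qp; rewrite mem_single.
  by split; [apply: iffL (allE u H)|apply: iffR (allE u H)].
apply: allI => u; fiff K; first by apply/mem_single/(mem_congr H).
by apply/(mem_congr (forces_eq_sym H))/mem_single.
Qed.

Lemma upair_congr p x y x' y' :
  (p ⊩ x ≐ x') -> (p ⊩ y ≐ y') -> (p ⊩ upair x y ≐ upair x' y').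
Proof.
move=> ex ey; apply/is_upairE.
have: p ⊩ fis_upair (upair x y) x y by apply/is_upairE/forces_eq_refl.
by apply: feqvP; feqv_solve.
Qed.

Lemma opair_congr p x y x' y' :
  (p ⊩ x ≐ x') -> (p ⊩ y ≐ y') -> (p ⊩ opair x y ≐ opair x' y').
Proof. by move=> ? ?; apply: upair_congr; apply: upair_congr. Qed.

Lemma is_pairE p z x y : (p ⊩ fis_pair z x y) <-> (p ⊩ z ≐ opair x y).
Proof.
split=> H.
  fex H a; fex H c.
  have [/is_singleE ea /andD [/is_upairE ec /is_upairE ez]] := andD H.
  by apply: forces_eq_trans ez _; apply: upair_congr.
apply: (@exI _ _ _ _ (upair x x)); apply: (@exI _ _ _ _ (upair x y)).
apply: andI; first exact/is_singleE/forces_eq_refl.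
by apply: andI; apply/is_upairE => //; exact: forces_eq_refl.
Qed.

Lemma opair_inj1 p x y x' y' : (p ⊩ opair x y ≐ opair x' y') -> (p ⊩ x ≐ x').
Proof.
move=> e; have: p ⊩ upair x x ∈ opair x' y'.
  by apply: mem_congr e _; apply/mem_upair/orIl/forces_eq_refl.
move=> /mem_upair H.
have E q z : (q ⊩ upair x x ≐ upair x' z) -> (q ⊩ x ≐ x').
  move=> K; apply/forces_eq_sym/mem_single/(mem_congr (forces_eq_sym K)).
  exact/mem_upair/orIl/forces_eq_refl.
by fcase H; exact: E H.
Qed.

Lemma opair_inj2 p x y x' y' : (p ⊩ opair x y ≐ opair x' y') -> (p ⊩ y ≐ y').
Proof.
move=> e; have ex := opair_inj1 e.
have mem2 q z u v w : (q ⊩ opair u v ≐ opair z w) ->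
    (q ⊩ v ≐ z ∨ v ≐ w).
  move=> K; have: q ⊩ upair u v ∈ opair z w.
    by apply: mem_congr K _; apply/mem_upair/orIr/forces_eq_refl.
  move=> /mem_upair L; have M r t : (r ⊩ upair u v ≐ t) -> (r ⊩ v ∈ t).
    by move=> E; apply: mem_congr E _; apply/mem_upair/orIr/forces_eq_refl.
  fcase L; first by have /mem_single := M _ _ L; exact: orIl.
  by have /mem_upair := M _ _ L.
(* The membership argument is used in both directions; in the crossed case [y] equals [x'] and [y']
   equals [x], and [x ≐ x'] closes the chain. *)
have H := mem2 _ _ _ _ _ e; have K := mem2 _ _ _ _ _ (forces_eq_sym e).
fcase H => //; fcase K; last exact: forces_eq_sym.
apply: forces_eq_trans H _.
exact: (forces_eq_trans (forces_eq_sym ex) (forces_eq_sym K)).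
Qed.

(** A function whose domain is a ground model set of numerals, with arbitrary names as values:
    histories and runs of the game have this form. *)
Definition graph (A : set nat) (v : nat -> name P) : name P :=
  Name (fun ip : {n | A n} * P => opair (vnat (sval ip.1))^ (v (sval ip.1)))
       (fun ip => ip.2).

Implicit Types (A : set nat) (f : nat -> name P).

Lemma mem_graphD p z A f : (p ⊩ z ∈ graph A f) ->
  exists n q, [/\ le q p, A n & q ⊩ z ≐ opair (vnat n)^ (f n)].
Proof.
move/forces_memE/(_ p (fo_refl p)) => [q qp [[[n An] r] /= [_ e]]].
by exists n, q.
Qed.

Lemma mem_graphE p z A f b : (p ⊩ z ∈ graph A f) ->
  (forall q n, le q p -> A n -> (q ⊩ z ≐ opair (vnat n)^ (f n)) -> (q ⊩ b)) ->
  (p ⊩ b).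
Proof.
move=> H K; apply: forces_dense => q qp; weaken qp.
by have [n [r [rq An e]]] := mem_graphD H; exists r => //; exact: K (fo_trans rq qp) An e.
Qed.

Lemma mem_graphI p z A f n : A n -> (p ⊩ z ≐ opair (vnat n)^ (f n)) ->
  (p ⊩ z ∈ graph A f).
Proof.
move=> An e; apply/forces_memE => q qp; exists q; first exact: fo_refl.
by exists (exist _ n An, q); split; [exact: fo_refl|exact: forces_mono e].
Qed.

Lemma graph_sub p A B f g : A `<=` B -> (forall n, A n -> f n = g n) ->
  p ⊩ fsubset (graph A f) (graph B g).
Proof.
move=> AB fg; apply: allI => z; fimp H.
by apply: (mem_graphE H) => r n _ An; rewrite fg //; apply: mem_graphI; exact: AB.
Qed.

Lemma fgraphI p A f n : A n -> p ⊩ fgraph (graph A f) (vnat n)^ (f n).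
Proof.
move=> An; apply: (@exI _ _ _ _ (opair (vnat n)^ (f n))).
by apply: andI; [apply/is_pairE|apply: mem_graphI An _]; exact: forces_eq_refl.
Qed.

Lemma fgraph_val p A f x y : (p ⊩ fgraph (graph A f) x y) ->
  exists n q, [/\ le q p, A n, q ⊩ x ≐ (vnat n)^ & q ⊩ y ≐ f n].
Proof.
move=> H; fex H z; have [/is_pairE e /mem_graphD [n [r [rq An e']]]] := andD H.
weaken rq; have e2 := forces_eq_trans (forces_eq_sym e) e'; exists n, r; split=> //.
- exact: opair_inj1 e2.
- exact: opair_inj2 e2.
Qed.

Lemma fgraph_valE p A f n y :
  (p ⊩ fgraph (graph A f) (vnat n)^ y) -> (p ⊩ y ≐ f n).
Proof.
move=> H; apply: forces_dense => q qp; weaken qp.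
have [m [r [rq Am /injective_vnat -> e]]] := fgraph_val H.
by exists r.
Qed.

Lemma fgraph_functional p A f x y y' : (p ⊩ fgraph (graph A f) x y) ->
  (p ⊩ fgraph (graph A f) x y') -> (p ⊩ y ≐ y').
Proof.
move=> H K; apply: forces_dense => q qp; weaken qp.
have [m [r [rq Am em e]]] := fgraph_val H; exists r => //; weaken rq.
have {}K : r ⊩ fgraph (graph A f) (vnat m)^ y' by apply: feqvP K; feqv_solve.
by apply: forces_eq_trans e _; apply: forces_eq_sym (fgraph_valE K).
Qed.

Lemma fatI p A f n phi :
  A n -> (p ⊩ phi (f n)) -> (p ⊩ fat (graph A f) (vnat n)^ phi).
Proof.
by move=> An H; apply: (@exI _ _ _ _ (f n)); apply: andI => //; exact: fgraphI.
Qed.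

Lemma fatD p A f n phi : (p ⊩ fat (graph A f) (vnat n)^ phi) ->
  fcongr le phi -> (p ⊩ phi (f n)).
Proof. by move=> H C; fex H y; have [/fgraph_valE e] := andD H; exact: C. Qed.

Lemma forces_function p A f phi : fcongr le phi ->
  (forall n, A n -> p ⊩ phi (f n)) ->
  p ⊩ ffun_from_to (graph A f) (fun x => x ∈ (vset_of vnat A)^)%fm phi.
Proof.
move=> C H; apply: andI.
  apply: allI => z; fimp K; apply: (mem_graphE K) => r n rq An e.
  apply: (@exI _ _ _ _ (vnat n)^); apply: (@exI _ _ _ _ (f n)).
  apply: andI; first exact/is_pairE.
  apply: andI; first exact: memI (forces_eq_refl _ _).
  exact: forces_mono (fo_trans rq Hq) (H n An).
apply: andI.
  apply: allI => x; fimp K; apply: (memE K) => r n rq An e.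
  apply: (@exI _ _ _ _ (f n)).
  have: r ⊩ fgraph (graph A f) (vnat n)^ (f n) by exact: fgraphI.
  by apply: feqvP; feqv_solve.
apply: allI => x; apply: allI => y; apply: allI => y'; fimp K; fimp L.
exact: fgraph_functional K L.
Qed.

End Pairs.

(** * Cardinalities of ground model sets in the extension *)

Section Sizes.
Context {P : Type} {le : forcing_order P}.
Implicit Types (p q r : P) (x y z g : name P).
Implicit Types phi psi : name P -> fm (name P).
Implicit Types X Y Z s : set (set nat).

Local Notation "p ⊩ a" := (forces le p a%fm) (at level 100, a at level 200).
Local Notation "x ^" := (check P x) (at level 2, format "x ^").
Local Notation absolute := (absolute le).

Lemma fgraph_type p g phi psi x y : fcongr le phi -> fcongr le psi ->
  (p ⊩ ffun_from_to g phi psi) -> (p ⊩ fgraph g x y) ->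
  (p ⊩ phi x) /\ (p ⊩ psi y).
Proof.
move=> Cphi Cpsi /andD [F _] H.
suff K : p ⊩ phi x ∧ psi y by exact: andD K.
fex H z; have [/is_pairE e zg] := andD H.
have K := impE (allE z F) zg; fex K x'; fex K y'.
have [/is_pairE e' /andD [Hx Hy]] := andD K.
have e2 := forces_eq_trans (forces_eq_sym e') e.
apply: andI; [apply: Cphi Hx|apply: Cpsi Hy].
- exact: opair_inj1 e2.
- exact: opair_inj2 e2.
Qed.

(** Finitely many decisions need no closure of the forcing: the condition is extended [k] times, and
    monotonicity preserves the earlier choices. [t0] only fills the values of [h] off
    [{0, ..., k - 1}]. *)
Lemma decide_finite T (t0 : T) (Q : nat -> T -> P -> Prop) p k :
  (forall i t q r, le r q -> Q i t q -> Q i t r) ->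
  (forall i q, i < k -> le q p -> exists t r, le r q /\ Q i t r) ->
  exists q h, le q p /\ forall i, i < k -> Q i (h i) q.
Proof.
move=> mono; elim: k => [|k IH] H.
  by exists p, (fun=> t0); split=> //; exact: fo_refl.
have [q [h [qp hQ]]] := IH (fun i r ik => H i r (ltnW ik)).
have [t [r [rq Qt]]] := H k q (ltnSn k) qp.
exists r, (fun i => if i == k then t else h i); split; first exact: fo_trans qp.
move=> i; rewrite ltnS leq_eqVlt; case: eqP => [->|_ /= ik] //.
exact: mono rq (hQ i ik).
Qed.

(** One condition decides all [k] values of the forced bijection, and the decided values form a
    bijection in the ground model. *)
Lemma equinumerous_card T (f : T -> vset) (A : set T) k p (t0 : T) :
  injective_code (le := le) f ->
  (p ⊩ fequinumerous (vset_of f A)^ (vnat k)^) -> A #= `I_k.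
Proof.
move=> f_inj H; fex H g; have [F /andD [_ S]] := andD H.
have typ r x y : (r ⊩ fgraph g x y) -> le r q ->
    (r ⊩ x ∈ (vnat k)^) /\ (r ⊩ y ∈ (vset_of f A)^).
  move=> K rq; weaken rq.
  by apply: fgraph_type F K; fcongr_solve.
have [_ /andD [tot fct]] := andD F.
have fct' r x y y' : (r ⊩ fgraph g x y) -> (r ⊩ fgraph g x y') -> le r q ->
    (r ⊩ y ≐ y').
  move=> K L rq; weaken rq.
  exact: impE (impE (allE y' (allE y (allE x fct))) K) L.
have [r [h [rq hP]]] : exists r h, le r q /\ forall i, i < k ->
    A (h i) /\ (r ⊩ fgraph g (vnat i)^ (f (h i))^).
  apply: (decide_finite t0 (Q := fun i t r => A t /\ (r ⊩ fgraph g (vnat i)^ (f t)^))).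
    by move=> i t s r rs [At G]; split=> //; exact: forces_mono G.
  move=> i r ik rq; weaken rq.
  have mk : r ⊩ (vnat i)^ ∈ (vnat k)^ by apply/mem_vnat/abs_mem_set.
  have K := impE (allE _ tot) mk; fex K y.
  have [_ /memD [t [s [sq At e]]]] := typ _ _ _ K rq.
  weaken sq; exists t, s; split=> //; split=> //;
  by apply: feqvP K; feqv_solve.
weaken rq.
have -> : A = h @` `I_k.
  rewrite predeqE => t; split=> [At|[i /= /hP [Ah _] <-]] //.
  have tA : r ⊩ (f t)^ ∈ (vset_of f A)^ by apply/(abs_mem f_inj).
  have K := impE (allE _ S) tA; fex K j.
  have [/mem_vnat/memD [i [s [sq0 /= ik e]]] _] := typ _ _ _ K rq.
  exists i => //; weaken sq0.
  have L : s ⊩ fgraph g (vnat i)^ (f t)^ by apply: feqvP K; feqv_solve.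
  have [_ M] := hP i ik; have {}M := forces_mono Hq0 M.
  apply/(f_inj (h i) t s); exact: fct' M L rq.
apply: inj_card_eq => i j; rewrite !inE /= => ik jk hij.
have [_ Ki] := hP i ik; have [_] := hP j jk; rewrite -hij => Kj.
apply/(injective_vnat i j r).
have /andD [J _] := (andD H).2.
exact: impE (impE (allE _ (allE _ (allE _ J))) Ki) Kj.
Qed.

Lemma succ_size_card p t s : (p ⊩ fsucc_size omega (vfamily t)^ (vfamily s)^) ->
  exists2 k, s #= `I_k & t #= `I_k.+1.
Proof.
move=> H; fex H k; fex H l; have [/memD [n [r [rq _ e]]] K] := andD H; weaken rq.
have {}K : r ⊩ fis_succ l (vnat n)^ ∧ fequinumerous (vfamily s)^ (vnat n)^ ∧
  fequinumerous (vfamily t)^ l by apply: feqvP K; feqv_solve.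
have [/is_succ_eq el /andD [Ks Kt]] := andD K.
have {}Kt : r ⊩ fequinumerous (vfamily t)^ (vnat n.+1)^ by apply: feqvP Kt; feqv_solve.
exists n; apply: equinumerous_card set0 (@injective_vset _ _) _; eassumption.
Qed.

Lemma ffinite_finite T (f : T -> vset) (A : set T) p (t0 : T) :
  injective_code (le := le) f ->
  (p ⊩ ffinite omega (vset_of f A)^) -> finite_set A.
Proof.
move=> f_inj H; fex H k; have [/memD [n [r [rq _ e]]] K] := andD H; weaken rq.
have {}K : r ⊩ fequinumerous (vset_of f A)^ (vnat n)^ by apply: feqvP K; feqv_solve.
by apply/finite_setP; exists n; exact: equinumerous_card K.
Qed.

Lemma abs_partition X : absolute (fpartition omega (vfamily X)^)
  (partial_partition X /\ pdom X = setT).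
Proof.
have -> : (pdom X = setT) = (forall n, setT n -> pdom X n).
  by rewrite propeqE predeqE; split=> [H n _|H n]; [exact/H|split=> // _; exact: H].
apply: abs_and; first exact: abs_partial_partition.
by apply: abs_all_in => [|n _]; [fcongr_solve|exact: abs_pdom].
Qed.

Lemma forces_inf_partition p X : inf_partition X ->
  p ⊩ finf_partition omega (vfamily X)^.
Proof.
move=> [Xp Xt Xi]; apply: andI; first exact/abs_partition.
apply: negI => q _ /(ffinite_finite set0 (@injective_vset _ _)); exact: Xi.
Qed.

Lemma fellentuckE p s X Y : inf_partition Y ->
  (p ⊩ fellentuck omega (vfamily s)^ (vfamily X)^ (vfamily Y)^) <->
  segment s Y /\ coarser Y X.
Proof.
move=> Yi; split.
  by move=> /andD [_ /andD [/abs_segment ? /abs_coarser]].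
move=> [sY YX]; apply: andI; first exact: forces_inf_partition.
by apply: andI; [exact/abs_segment|exact/abs_coarser].
Qed.

End Sizes.

(** * Countably closed forcing adds no partitions *)

Section NoNewPartitions.
Context {P : Type} {le : forcing_order P}.
Implicit Types (p q r : P) (x y z g : name P).
Implicit Types X Y Z s : set (set nat).

Local Notation "p ⊩ a" := (forces le p a%fm) (at level 100, a at level 200).
Local Notation "x ^" := (check P x) (at level 2, format "x ^").
Local Notation absolute := (absolute le).

Definition sigma_closed := forall ps : nat -> P,
  (forall n, le (ps n.+1) (ps n)) -> exists q, forall n, le q (ps n).

Hypothesis le_sigma : sigma_closed.

Lemma decide p a : exists q, le q p /\ ((q ⊩ a) \/ (q ⊩ ¬ a)).
Proof.
have [[q qp qa]|N] := pselect (exists2 q, le q p & q ⊩ a); first by exists q; auto.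
exists p; split; first exact: fo_refl.
by right; apply: negI => q qp qa; apply: N; exists q.
Qed.

Lemma decide_countable p (a : nat -> fm (name P)) :
  exists q, le q p /\ forall n, (q ⊩ a n) \/ (q ⊩ ¬ a n).
Proof.
have /choice [D HD] (qn : P * nat) := decide qn.1 (a qn.2).
pose ps := fix ps n := if n is m.+1 then D (ps m, m) else p.
have [n|q Hq] := @le_sigma ps; first by have [] := HD (ps n, n).
exists q; split; first exact: (Hq 0).
move=> n; have [_ [H|H]] := HD (ps n, n); [left|right];
  exact: forces_mono (Hq n.+1) H.
Qed.

(** Below a condition that decides every statement [n ∈ x], the set of those [n] forced into [x] is
    [x]. *)
Lemma no_new_set p x : (p ⊩ fsubset x omega) ->
  exists A q, le q p /\ (q ⊩ x ≐ (vset_of vnat A)^).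
Proof.
move=> H; have [q [qp Hq]] := decide_countable p (fun n => (vnat n)^ ∈ x)%fm.
weaken qp; exists [set n | q ⊩ (vnat n)^ ∈ x], q; split=> //.
apply: eq_ext => r z rq; weaken rq; split=> Hz.
- apply: (memE (impE (allE z H) Hz)) => s n sr _ e; weaken sr.
  have Hn : s ⊩ (vnat n)^ ∈ x by apply: mem_congl e Hz.
  apply: memI e => /=; have [//|N] := Hq n.
  by case: (negD (forces_mono rq N) Hn).
- apply: (memE Hz) => s n sr /= Hn e; weaken sr.
  by apply: mem_congl (forces_eq_sym e) _; exact: forces_mono rq Hn.
Qed.

(** [x] is determined by which pairs of naturals share a block; these are
    countably many statements to decide. *)
Lemma no_new_partition p x : (p ⊩ fpartial_partition omega x) ->
  exists X q, [/\ le q p, partial_partition X & q ⊩ x ≐ (vfamily X)^].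
Proof.
move=> H; pose a i j := (∃ b, b ∈ x ∧ (vnat i)^ ∈ b ∧ (vnat j)^ ∈ b)%fm.
(* The pairs [(i, j)] are enumerated by [pickle]; [a 0 0] is a filler for numbers that code no
   pair. *)
have [q [qp Hq]] := decide_countable p
  (fun n => if unpickle n is Some (i, j) then a i j else a 0 0).
have {}Hq i j : (q ⊩ a i j) \/ (q ⊩ ¬ a i j).
  by have := Hq (pickle (i, j)); rewrite pickleK.
weaken qp; have [H1 H2] := andD H.
pose E i := [set j | q ⊩ a i j].
pose X := [set b | exists2 i, E i i & b = E i].
(* Blocks that meet are equal, so a block of [x] through [i] consists of exactly the numbers decided
   to share a block with [i]. *)
have blk r z i : (r ⊩ z ∈ x) -> (r ⊩ (vnat i)^ ∈ z) -> le r q ->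
    (r ⊩ z ≐ (vset_of vnat (E i))^).
  move=> Hz Hi rq; weaken rq; apply: eq_ext => s u sr; weaken sr; split=> Hu.
  - have [zw _] := andD (impE (allE z H1) Hz).
    apply: (memE (impE (allE u zw) Hu)) => t j ts _ e; weaken ts.
    have Hj : t ⊩ (vnat j)^ ∈ z by apply: mem_congl e Hu.
    apply: memI e => /=.
    have [//|N] := Hq i j.
    case: (negD (forces_mono rq N)).
    by apply: (@exI _ _ _ _ z); apply: andI => //; apply: andI.
  - apply: (memE Hu) => t j ts /= K e; weaken ts.
    have {}K : t ⊩ a i j by exact: forces_mono rq K.
    fex K c; have [cx /andD [ic jc]] := andD K.
    have zc : q0 ⊩ z ≐ c.
      apply: (impE (impE (impE (allE c (allE z H2)) Hz) cx)).
      by apply: (@exI _ _ _ _ (vnat i)^); apply: andI.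
    by apply: mem_congr (forces_eq_sym zc) _; apply: mem_congl (forces_eq_sym e) jc.
have e : q ⊩ x ≐ (vfamily X)^.
  apply: eq_ext => r z rq; weaken rq; split=> Hz.
  - have [zw nz] := andD (impE (allE z H1) Hz).
    fex nz u; apply: (memE (impE (allE u zw) nz)) => s i sq0 _ eu.
    weaken sq0; have Hi : s ⊩ (vnat i)^ ∈ z by apply: mem_congl eu nz.
    apply: (@memI _ _ _ _ _ _ _ (E i)); last first.
      by apply: blk => //; exact: rq.
    exists i => //=; have [//|N] := Hq i i.
    case: (negD (forces_mono rq N)).
    by apply: (@exI _ _ _ _ z); apply: andI => //; apply: andI.
  - apply: (family_memE Hz) => s b sr [i /= Ki ->] ez; weaken sr.
    have {}Ki : s ⊩ a i i by exact: forces_mono rq Ki.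
    fex Ki c.
    have [cx /andD [ic _]] := andD Ki.
    have ec : q0 ⊩ c ≐ (vset_of vnat (E i))^ by apply: blk.
    by apply: mem_congl (forces_eq_trans ec (forces_eq_sym ez)) cx.
exists X, q; split=> //; apply/(abs_partial_partition X q).
by apply: feqvP H; feqv_solve.
Qed.

Lemma abs_common_coarsening Z X Y : absolute
  (fcommon_coarsening omega (vfamily Z)^ (vfamily X)^ (vfamily Y)^)
  (common_coarsening Z X Y).
Proof.
have E : absolute (∀ n, fin_pdom n (vfamily Z)^ ⇔
      (fin_pdom n (vfamily X)^ ∨ fin_pdom n (vfamily Y)^))%fm
    (forall n, pdom Z n <-> pdom X n \/ pdom Y n).
  apply: abs_all_iff; try by fcongr_solve.
  - by move=> p x; exact: pdom_mem_omega.
  - by move=> p x H; fcase H; exact: pdom_mem_omega H.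
  - by move=> n; exact: abs_pdom.
  - by move=> n; apply: abs_or; exact: abs_pdom.
have -> : common_coarsening Z X Y = (partial_partition Z /\
  (forall n, pdom Z n <-> pdom X n \/ pdom Y n) /\ coarser Z X /\ coarser Z Y).
  rewrite propeqE; split=> [[? e ? ?]|[? [e [? ?]]]].
  - by split=> //; split=> // n; rewrite e.
  - by split=> //; rewrite predeqE.
apply: abs_and; first exact: abs_partial_partition.
by apply: abs_and; [exact: E|apply: abs_and; exact: abs_coarser].
Qed.

(** Being the finest quantifies over all partial partitions of the extension; as none is new, those
    of the ground model suffice. *)
Lemma abs_is_meet Z X Y :
  absolute (fis_meet omega (vfamily Z)^ (vfamily X)^ (vfamily Y)^) (is_meet Z X Y).
Proof.
apply: abs_and; first exact: abs_common_coarsening.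
move=> p; split=> [H Z' Z'XY|H].
  apply/(abs_coarser Z' Z p); apply: impE (allE _ H) _.
  exact/abs_common_coarsening.
apply: allI => z; fimp K; apply: forces_dense => r rq; weaken rq.
have [Z' [s [sr _ e]]] := no_new_partition (andD K).1; exists s => //; weaken sr.
have {}K : s ⊩ fcommon_coarsening omega (vfamily Z')^ (vfamily X)^ (vfamily Y)^.
  by apply: feqvP K; feqv_solve.
have L : s ⊩ fcoarser (vfamily Z')^ (vfamily Z)^.
  by apply/abs_coarser/H; apply/abs_common_coarsening; exact: K.
by apply: feqvP L; feqv_solve.
Qed.

(** Both witnesses, the finite set and the meet, are subsets or partial partitions of natural
    numbers and hence lie in the ground model. This serves to refute almost equality in the
    extension. *)
Lemma forces_coarser_ae p X Y :
  (p ⊩ fcoarser_ae omega (vfamily X)^ (vfamily Y)^) -> coarser_ae X Y.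
Proof.
move=> H; fex H f; have [fin /andD [fX K]] := andD H.
have /no_new_set [A [r [rq ef]]] : q ⊩ fsubset f omega.
  apply: allI => x; fimp Hx; have Kx := impE (allE x fX) Hx.
  exact: pdom_mem_omega Kx.
weaken rq; exists A.
have {}fin : r ⊩ ffinite omega (vset_of vnat A)^ by apply: feqvP fin; feqv_solve.
have {}fX n : A n -> pdom X n.
  move=> An; apply/(abs_pdom n X r); apply: impE (allE _ fX) _.
  by apply: mem_congr (forces_eq_sym ef) _; apply/abs_mem_set.
have {}K : r ⊩ ∃ F u, fis_singleton F (vset_of vnat A)^ ∧
  fis_meet omega u (vfamily X)^ F ∧ fcoarser u (vfamily Y)^.
  by apply: feqvP K; feqv_solve.
split=> //; first exact: ffinite_finite 0 (@injective_vnat _ _) fin.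
fex K F; fex K z; have [/is_singletonE eF /andD [M C]] := andD K.
have [Z [s [sq _ ez]]] := no_new_partition (andD (andD M).1).1; weaken sq.
have {}M : s ⊩ fis_meet omega (vfamily Z)^ (vfamily X)^ (vfamily [set A])^.
  by apply: feqvP M; feqv_solve.
have {}C : s ⊩ fcoarser (vfamily Z)^ (vfamily Y)^ by apply: feqvP C; feqv_solve.
exists Z; first by apply/(abs_is_meet Z X [set A] s).
apply/(abs_coarser Z Y s); exact: C.
Qed.

End NoNewPartitions.

Unset Maximal Implicit Insertion.

(** * Partitions as equivalence relations *)

Definition eqv (X : set (set nat)) (i j : nat) : Prop :=
  exists2 b, X b & b i /\ b j.

(** Nonemptiness of blocks is left out because in $X\sqcap\{f\}$ the finite set [f] may be empty. *)
Definition disjoint_blocks (X : set (set nat)) : Prop :=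
  forall b c, X b -> X c -> b `&` c !=set0 -> b = c.

(** No reflexivity: the relation of a partial partition is empty off its domain. *)
Definition is_per (E : nat -> nat -> Prop) : Prop :=
  (forall i j, E i j -> E j i) /\ (forall i j k, E i j -> E j k -> E i k).

Lemma per_sym E i j : is_per E -> E i j -> E j i.
Proof. by move=> [sE _]; exact: sE. Qed.

Lemma per_trans E i j k : is_per E -> E i j -> E j k -> E i k.
Proof. by move=> [_ tE]; exact: tE. Qed.

Definition classes (E : nat -> nat -> Prop) : set (set nat) :=
  [set b | exists2 i, E i i & b = [set j | E i j]].

Lemma setI_neq0 T (b c : set T) i : b i -> c i -> b `&` c !=set0.
Proof. by move=> bi ci; exists i; split. Qed.

Section Blocks.
Implicit Types (X Y Z s t : set (set nat)) (E R S : nat -> nat -> Prop).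
Implicit Types i j k n : nat.

Lemma eqv_refl X i : eqv X i i <-> pdom X i.
Proof. by split=> [[b Xb [bi _]]|[b Xb bi]]; exists b. Qed.

Lemma eqv_sym X i j : eqv X i j -> eqv X j i.
Proof. by move=> [b Xb [bi bj]]; exists b. Qed.

Lemma eqv_dom X i j : eqv X i j -> pdom X i.
Proof. by move=> [b Xb [bi bj]]; exists b. Qed.

Lemma eqv_trans X i j k :
  disjoint_blocks X -> eqv X i j -> eqv X j k -> eqv X i k.
Proof.
move=> D [b Xb [bi bj]] [c Xc [cj ck]].
have e : b = c by apply: D => //; exact: setI_neq0 bj cj.
by exists b => //; split=> //; rewrite e.
Qed.

Lemma eqv_per X : disjoint_blocks X -> is_per (eqv X).
Proof. by move=> D; split=> [i j|i j k]; [exact: eqv_sym|exact: eqv_trans]. Qed.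

Lemma blockE X b i : disjoint_blocks X -> X b -> b i -> b = [set j | eqv X i j].
Proof.
move=> D Xb bi; rewrite predeqE => j; split=> [bj|[c Xc [ci cj]]]; first by exists b.
by rewrite (D b c) //; exact: setI_neq0 bi ci.
Qed.

Lemma eqv_classes E i j : is_per E -> eqv (classes E) i j <-> E i j.
Proof.
move=> EP; split=> [[b [k Ek ->] [/= ki kj]]|Eij].
  exact: per_trans EP (per_sym EP ki) kj.
have Eii : E i i by exact: per_trans EP Eij (per_sym EP Eij).
by exists [set j | E i j] => //; exists i.
Qed.

Lemma partial_partition_classes E : is_per E -> partial_partition (classes E).
Proof.
move=> EP; split=> [b [i Ei ->]|b c [i Ei ->] [j Ej ->] [k [/= ik jk]]].
  by exists i.
rewrite predeqE => l; split=> /= H.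
- exact: per_trans EP jk (per_trans EP (per_sym EP ik) H).
- exact: per_trans EP ik (per_trans EP (per_sym EP jk) H).
Qed.

Lemma eq_blocks X Y : partial_partition X -> partial_partition Y ->
  (forall i j, eqv X i j <-> eqv Y i j) -> X = Y.
Proof.
have sub X' Y' : partial_partition X' -> partial_partition Y' ->
    (forall i j, eqv X' i j <-> eqv Y' i j) -> X' `<=` Y'.
  move=> [nX dX] [nY dY] H b Xb; have [i bi] := nX b Xb.
  have [c Yc [ci _]] : eqv Y' i i by apply/H; exists b.
  suff -> : b = c by [].
  rewrite (blockE dX Xb bi) (blockE dY Yc ci).
  by rewrite predeqE => j; exact: H.
move=> pX pY H; rewrite eqEsubset; split; apply: sub => //.
by move=> i j; apply: iff_sym.
Qed.

Lemma coarserE X Y : disjoint_blocks X -> disjoint_blocks Y ->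
  coarser X Y <->
  forall i j, pdom X i -> pdom X j -> eqv Y i j -> eqv X i j.
Proof.
move=> dX dY; split=> [H i j [b Xb bi] Xj [c Yc [ci cj]]|H b Xb].
  have [C CY /predeqP bE] := H b Xb.
  have [|d Cd [di Xi]] := (bE i).1; first by split=> //; exists c.
  have cd : c = d by apply: dY; [| |exact: setI_neq0 ci di] => //; exact: CY.
  have [bj _] : (b `&` pdom Y) j by apply/bE; exists d => //; rewrite -cd.
  by exists b.
exists [set c | Y c /\ c `&` pdom X `<=` b] => [c []//|].
rewrite predeqE => i; split=> [[bi [c Yc ci]]|[c [Yc cb] [ci Xi]]]; last first.
  by split; [exact: cb|exists c].
exists c; last by split=> //; exists b.
split=> // j [cj Xj]; have [||d Xd [di dj]] := H i j _ Xj.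
- by exists b.
- by exists c.
- by rewrite (dX b d) //; exact: setI_neq0 bi di.
Qed.

(** The partial equivalence relation generated by both, taken as an intersection rather than by
    paths, so that inclusions follow by instantiating [E]. *)
Definition meet_eqv X Y i j : Prop := forall E, is_per E ->
  (forall i j, eqv X i j -> E i j) -> (forall i j, eqv Y i j -> E i j) -> E i j.

Lemma meet_eqv_per X Y : is_per (meet_eqv X Y).
Proof.
split=> [i j H E EP XE YE|i j k H K E EP XE YE].
- by apply: (per_sym EP); exact: H.
- by apply: (per_trans EP (j := j)); [exact: H|exact: K].
Qed.

Lemma meet_eqv_dom X Y i j : meet_eqv X Y i j -> pdom X i \/ pdom Y i.
Proof.
pose E i j := (pdom X i \/ pdom Y i) /\ (pdom X j \/ pdom Y j).
move=> H; suff [] : E i j by []; apply: H.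
- by split=> [? ? []|? ? ? [? _] []].
- by move=> k l H; split; left; [exact: eqv_dom H|exact: eqv_dom (eqv_sym H)].
- by move=> k l H; split; right; [exact: eqv_dom H|exact: eqv_dom (eqv_sym H)].
Qed.

Lemma meet_eqvl X Y i j : eqv X i j -> meet_eqv X Y i j.
Proof. by move=> H E _ XE _; exact: XE. Qed.

Lemma meet_eqvr X Y i j : eqv Y i j -> meet_eqv X Y i j.
Proof. by move=> H E _ _; apply. Qed.

Definition meet X Y := classes (meet_eqv X Y).

Lemma eqv_meet X Y i j : eqv (meet X Y) i j <-> meet_eqv X Y i j.
Proof. exact/eqv_classes/meet_eqv_per. Qed.

Lemma partial_partition_meet X Y : partial_partition (meet X Y).
Proof. exact/partial_partition_classes/meet_eqv_per. Qed.

Lemma pdom_meet X Y : pdom (meet X Y) = pdom X `|` pdom Y.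
Proof.
rewrite predeqE => i; rewrite -eqv_refl eqv_meet; split=> [/meet_eqv_dom //|].
by move=> [/eqv_refl|/eqv_refl]; [exact: meet_eqvl|exact: meet_eqvr].
Qed.

Lemma is_meet_meet X Y :
  disjoint_blocks X -> disjoint_blocks Y -> is_meet (meet X Y) X Y.
Proof.
move=> dX dY; have pM := partial_partition_meet X Y.
split.
  split=> //; first exact: pdom_meet.
  - apply/coarserE => //; first exact: pM.2.
    by move=> i j _ _ H; apply/eqv_meet; exact: meet_eqvl.
  - apply/coarserE => //; first exact: pM.2.
    by move=> i j _ _ H; apply/eqv_meet; exact: meet_eqvr.
move=> Z [[_ dZ] Ze /coarserE ZX /coarserE ZY].
apply/coarserE => //; first exact: pM.2.
have Zx i : pdom X i -> pdom Z i by move=> ?; rewrite Ze; left.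
have Zy i : pdom Y i -> pdom Z i by move=> ?; rewrite Ze; right.
move=> i j _ _ /eqv_meet; apply; first exact: eqv_per.
- move=> k l H; apply: ZX => //; apply: Zx; first exact: eqv_dom H.
  exact: eqv_dom (eqv_sym H).
- move=> k l H; apply: ZY => //; apply: Zy; first exact: eqv_dom H.
  exact: eqv_dom (eqv_sym H).
Qed.

(** Two meets are coarser than each other and share their domain, so they have the same relation;
    the generated one is thus the relation of every meet. *)
Lemma is_meet_eqv Z X Y i j : disjoint_blocks X -> disjoint_blocks Y ->
  is_meet Z X Y -> eqv Z i j <-> meet_eqv X Y i j.
Proof.
move=> dX dY [[[nZ dZ] Ze ZX ZY] Zmin].
have [[_ Me MX MY] Mmin] := is_meet_meet dX dY.
have pM := partial_partition_meet X Y.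
have ZM : coarser Z (meet X Y).
  by apply: Mmin; split.
have MZ : coarser (meet X Y) Z by apply: Zmin; split.
have domE k l : eqv Z k l -> pdom (meet X Y) k.
  by move=> /eqv_dom; rewrite pdom_meet -Ze.
have domE' k l : eqv (meet X Y) k l -> pdom Z k.
  by move=> /eqv_dom; rewrite pdom_meet -Ze.
rewrite -eqv_meet; split=> H.
- move/coarserE: MZ; apply=> //; first exact: pM.2.
    exact: domE H.
  exact: domE (eqv_sym H).
- move/coarserE: ZM; apply=> //; first exact: pM.2.
    exact: domE' H.
  exact: domE' (eqv_sym H).
Qed.

(** For [E = eqv X], the equivalence of [X ⊓ {f}] with [f = {0, ..., N - 1}]. *)
Definition merge N E i j : Prop :=
  E i j \/ (exists2 a, a < N & E i a) /\ (exists2 b, b < N & E j b).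

Lemma merge_per N E : is_per E -> is_per (merge N E).
Proof.
move=> EP; split=> [i j [H|[? ?]]|i j k]; [by left; exact: per_sym|by right|].
move=> [H|[Hi [b bN Hj]]] [K|[[b' b'N Kj] Hk]].
- by left; exact: per_trans K.
- by right; split=> //; exists b' => //; exact: per_trans Kj.
- by right; split=> //; exists b => //; exact: per_trans (per_sym EP K) Hj.
- by right; split.
Qed.

Lemma finite_nat_bounded (A : set nat) :
  finite_set A -> exists N, forall n, A n -> n < N.
Proof.
move=> /finite_seqP [s ->]; exists (\max_(i <- s) i).+1 => n /= ns.
by rewrite ltnS; apply: leq_bigmax_seq.
Qed.

(** The finite set can be enlarged to an initial segment, and the meet with an initial segment is
    explicit: the classes that meet it become one. *)
Lemma coarser_aeP X Y : partial_partition X -> pdom X = setT ->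
  partial_partition Y -> 
  coarser_ae X Y <-> exists N, forall i j, eqv Y i j -> merge N (eqv X) i j.
Proof.
move=> [nX dX] Xt [nY dY]; have dF (f : set nat) : disjoint_blocks [set f].
  by move=> b c -> ->.
have XR i : eqv X i i by apply/eqv_refl; rewrite Xt.
split=> [[f [fin _ [Z M ZY]]]|[N H]].
  have [N fN] := finite_nat_bounded fin; exists N => i j Yij.
  have Zt k : pdom Z k by case: M => -[_ -> _ _] _; rewrite Xt; left.
  have dZ : disjoint_blocks Z by case: M => -[[]].
  have /coarserE H := ZY.
  have /(is_meet_eqv _ _ dX (dF f) M) := H dZ dY i j (Zt i) (Zt j) Yij.
  apply; [exact/merge_per/eqv_per|by left|].
  move=> k l [b -> [fk fl]]; right.
  by split; [exists k|exists l] => //; exact: fN.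
exists `I_N; split; [exact: finite_II|by rewrite Xt|].
exists (meet X [set `I_N]); first exact: is_meet_meet.
have pM := partial_partition_meet X [set `I_N].
apply/coarserE => //; first exact: pM.2.
move=> i j _ _ /H Hij; apply/eqv_meet => E EP XE FE.
case: Hij => [/XE //|[[a aN ia] [b bN jb]]].
apply: (per_trans EP (XE _ _ ia)); apply: (per_trans EP) (per_sym EP (XE _ _ jb)).
by apply: FE; exists `I_N.
Qed.

(** Infinitely many classes, phrased as: no initial segment meets all of them. In this form it
    visibly survives finite merging and passes to smaller relations. *)
Definition inf_classes E := forall N, exists i, forall a, a < N -> ~ E i a.

Lemma inf_classesP X : partial_partition X -> pdom X = setT ->
  infinite_set X <-> inf_classes (eqv X).
Proof.
move=> [nX dX] Xt; have XR i : eqv X i i by apply/eqv_refl; rewrite Xt.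
split=> [Xinf N|H Xfin].
  apply: contrapT => C; apply: Xinf.
  apply: (@sub_finite_set _ _ ((fun a => [set j | eqv X a j]) @` `I_N)); last first.
    exact/finite_image/finite_II.
  move=> b Xb; have [i bi] := nX b Xb.
  have [a aN ia] : exists2 a, a < N & eqv X i a.
    apply: contrapT => C'; apply: C; exists i => a aN ia; apply: C'; by exists a.
  exists a => //; rewrite -(blockE dX Xb) //.
  by have := blockE dX Xb bi => /predeqP/(_ a)/= ->.
have /choice [rep Hrep] (b : set nat) : exists i, X b -> b i.
  have [Xb|N] := pselect (X b); last by exists 0.
  by have [i bi] := nX b Xb; exists i.
have [N HN] := finite_nat_bounded (finite_image rep Xfin).
have [i Hi] := H N; have [b Xb [bi _]] := XR i.
apply: (Hi (rep b)); first by apply: HN; exists b.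
by exists b => //; split=> //; exact: Hrep.
Qed.

Lemma segmentE s Y k : partial_partition s -> pdom s = `I_k ->
  partial_partition Y -> pdom Y = setT ->
  segment s Y <-> forall i j, i < k -> j < k -> eqv s i j <-> eqv Y i j.
Proof.
move=> [ns ds] sk [nY dY] Yt; have sdom i : pdom s i <-> i < k by rewrite sk.
split=> [H i j ik jk|H b sb].
  split=> [[b sb [bi bj]]|[c Yc [ci cj]]].
    have [c Yc bc] := H b sb; exists c => //.
    by have [[? _] [? _]] := ((bc i).1 bi, (bc j).1 bj).
  have [b sb bi] := (sdom i).2 ik; have [d Yd bd] := H b sb.
  have dc : d = c.
    by apply: dY => //; apply: setI_neq0 ci; have [] := (bd i).1 bi.
  exists b => //; split=> //; apply/bd; split; first by rewrite dc.
  exact/sdom.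
have [i bi] := ns b sb; have ik : i < k by apply/sdom; exists b.
have [c Yc [ci _]] : eqv Y i i by apply/eqv_refl; rewrite Yt.
exists c => // n; rewrite (blockE ds sb bi) (blockE dY Yc ci) /=; split=> [H1|[H1 H2]].
- have sn := eqv_dom (eqv_sym H1); split=> //; apply/H => //; exact/sdom.
- by apply/H => //; exact/sdom.
Qed.

Lemma eqv_star t k i j : eqv (star t k) i j <-> eqv t i j \/ i = k /\ j = k.
Proof.
split=> [[b [tb [bi bj]|-> [-> ->]]]|[[b tb [bi bj]]|[-> ->]]]; [|by right| |].
- by left; exists b.
- by exists b => //; left.
- by exists [set k] => //; right.
Qed.

Lemma pdom_star t k : pdom t = `I_k -> pdom (star t k) = `I_k.+1.
Proof.
move=> tk; rewrite predeqE => i; rewrite -eqv_refl eqv_star eqv_refl tk /=.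
rewrite ltnS (leq_eqVlt i k).
by split=> [[->|[-> _]]|/predU1P[]]; rewrite ?eqxx ?orbT; auto.
Qed.

Lemma partial_partition_star t k : partial_partition t -> pdom t = `I_k ->
  partial_partition (star t k).
Proof.
move=> [nt dt] tk.
have N b : t b -> ~ b k.
  move=> tb bk; suff: pdom t k by rewrite tk /= ltnn.
  by exists b.
split=> [b [/nt //|->]|b c [tb|->] [tc|->] [i [bi ci]]] //; first by exists k.
- by apply: dt => //; exact: setI_neq0 bi ci.
- by case: (N b tb); rewrite -ci.
- by case: (N c tc); rewrite -bi.
Qed.

End Blocks.

(** * Amalgamation and fusion *)

Section Ud.
Implicit Types (p q r : Ud) (E S : nat -> nat -> Prop).

Definition ueqv p : nat -> nat -> Prop := eqv (sval p).

Lemma Ud_partial_partition p : partial_partition (sval p).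
Proof. by case: p => X []. Qed.

Lemma Ud_disjoint p : disjoint_blocks (sval p).
Proof. exact: (Ud_partial_partition p).2. Qed.

Lemma Ud_pdom p : pdom (sval p) = setT.
Proof. by case: p => X []. Qed.

Lemma ueqv_refl p i : ueqv p i i.
Proof. by apply/eqv_refl; rewrite Ud_pdom. Qed.

Lemma ueqv_per p : is_per (ueqv p).
Proof. by apply: eqv_per; exact: Ud_disjoint. Qed.

Lemma ueqv_sym p i j : ueqv p i j -> ueqv p j i.
Proof. by apply: per_sym; exact: ueqv_per. Qed.

Lemma ueqv_trans p i j k : ueqv p i j -> ueqv p j k -> ueqv p i k.
Proof. by apply: per_trans; exact: ueqv_per. Qed.

Lemma ueqv_inf p : inf_classes (ueqv p).
Proof.
apply/inf_classesP; [exact: Ud_partial_partition|exact: Ud_pdom|].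
by case: p => X [].
Qed.

Lemma Ud_of_equiv E : is_per E -> (forall i, E i i) -> inf_classes E ->
  exists q, forall i j, ueqv q i j <-> E i j.
Proof.
move=> EP ER Einf; have eE i j := eqv_classes i j EP.
have pp := partial_partition_classes EP.
have dT : pdom (classes E) = setT.
  by rewrite predeqE => i; rewrite -eqv_refl eE.
have H : inf_partition (classes E).
  split=> //; apply/inf_classesP => // N; have [i Hi] := Einf N.
  by exists i => a aN /eE; exact: Hi.
by exists (exist _ _ H).
Qed.

Lemma Ud_coarserP p q : coarser (sval p) (sval q) <->
  forall i j, ueqv q i j -> ueqv p i j.
Proof.
rewrite coarserE; try exact: Ud_disjoint.
by rewrite Ud_pdom; split=> H i j; [exact: H|move=> _ _; exact: H].
Qed.

Lemma Ud_leP p q :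
  Ud_le p q <-> exists N, forall i j, ueqv q i j -> merge N (ueqv p) i j.
Proof.
apply: coarser_aeP; by [exact: Ud_partial_partition|exact: Ud_pdom].
Qed.

Lemma coarser_Ud_le p q : coarser (sval p) (sval q) -> Ud_le p q.
Proof. by move=> /Ud_coarserP H; apply/Ud_leP; exists 0 => i j /H; left. Qed.

Lemma Ud_le_refl p : Ud_le p p.
Proof. by apply: coarser_Ud_le; apply/Ud_coarserP. Qed.

Lemma Ud_le_trans p q r : Ud_le p q -> Ud_le q r -> Ud_le p r.
Proof.
move=> /Ud_leP [N HN] /Ud_leP [M HM]; apply/Ud_leP; exists (maxn N M).
have mono i j : merge N (ueqv p) i j -> merge (maxn N M) (ueqv p) i j.
  move=> [|[[a aN ia] [b bN jb]]]; first by left.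
  by right; split; [exists a|exists b] => //; rewrite leq_max ?aN ?bN.
(* The merging that leads from [r] to [q] is tracked in [p]: either [a] itself is a representative,
   or [i] was already merged at the first stage. *)
have hit i a : a < M -> ueqv q i a ->
    exists2 a', a' < maxn N M & ueqv p i a'.
  move=> aM /HN [ia|[[b bN ib] _]].
    by exists a; rewrite // leq_max aM orbT.
  by exists b; rewrite // leq_max bN.
move=> i j /HM [/HN /mono //|[[a aM ia] [b bM jb]]].
by right; split; [exact: hit ia|exact: hit jb].
Qed.

Definition Ud_order : forcing_order Ud := ForcingOrder Ud_le_refl Ud_le_trans.

(** Positivity of [d] makes the class of [0] available as the target of those [p]-classes that miss
    [{0, ..., d - 1}]. *)
Lemma amalgamate_pos p r d S : 0 < d -> Ud_le r p -> is_per S ->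
  (forall i, i < d -> S i i) ->
  (forall i j, i < d -> j < d -> ueqv p i j -> S i j) ->
  exists q, [/\ coarser (sval q) (sval p), Ud_le q r, Ud_le r q &
    forall i j, i < d -> j < d -> ueqv q i j <-> S i j].
Proof.
move=> d0 /Ud_leP [N HN] SP SR Sp.
(* [M] is at least [N], so both points of a pair of [p] not respected by [r] lie in [B], and at
   least [d], so that the prescribed initial segment lies in [B]. *)
pose M := maxn N d; pose B i := exists2 a, a < M & ueqv r i a.
(* Up to finitely many classes [q] is [r]; the classes of [r] that meet
   [{0, ..., M - 1}] are redistributed over the classes of [S], where the
   [p]-class of [i] goes to the [S]-class of [h i]. *)
have /choice [h Hh] i : exists a, a < d /\
    (ueqv p i a \/ a = 0 /\ forall a', a' < d -> ~ ueqv p i a').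
  have [[a ad ia]|C] := pselect (exists2 a, a < d & ueqv p i a).
    by exists a; auto.
  by exists 0; split=> //; right; split=> // a ad ia; apply: C; exists a.
have hd i : h i < d by case: (Hh i).
have hS i j : ueqv p i j -> S (h i) (h j).
  move=> ij; have [_ [ih|[h0 Ni]]] := Hh i; have [_ [jh|[h0' Nj]]] := Hh j.
  - apply: Sp => //; apply: ueqv_trans (ueqv_sym ih) _.
    exact: ueqv_trans ij jh.
  - by case: (Nj (h i)) => //; apply: ueqv_trans (ueqv_sym ij) ih.
  - by case: (Ni (h j)) => //; apply: ueqv_trans ij jh.
  - by rewrite h0 h0'; apply: SR.
have hlt i : i < d -> S i (h i).
  move=> id; apply: Sp => //; have [_ [//|[_ Ni]]] := Hh i.
  by case: (Ni i id); exact: ueqv_refl.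
have Br i j : ueqv r i j -> B i -> B j.
  by move=> ij [a aM ia]; exists a => //; exact: ueqv_trans (ueqv_sym ij) ia.
pose E i j := (~ B i /\ ~ B j /\ ueqv r i j) \/ (B i /\ B j /\ S (h i) (h j)).
have EP : is_per E.
  split=> [i j [[? [? ?]]|[? [? ?]]]|i j k].
  - by left; split=> //; split=> //; exact: ueqv_sym.
  - by right; split=> //; split=> //; exact: per_sym.
  move=> [[? [? ?]]|[? [? ?]]] [[? [? ?]]|[? [? ?]]] //.
  - by left; split=> //; split=> //; apply: ueqv_trans; eassumption.
  - by right; split=> //; split=> //; apply: per_trans; eassumption.
have ER i : E i i.
  have [Bi|Bi] := pselect (B i); [right|left]; split=> //; split=> //.
    exact: SR.
  exact: ueqv_refl.
have Einf : inf_classes E.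
  move=> K; have [i Hi] := ueqv_inf r (maxn K M); exists i => a aK.
  have Bi : ~ B i.
    by move=> [b bM ib]; apply: (Hi b) ib; rewrite leq_max bM orbT.
  move=> [[_ [_ ia]]|[]//]; apply: (Hi a) ia; by rewrite leq_max aK.
have Blt i : i < d -> B i.
  by move=> id; exists i; [rewrite leq_max id orbT|exact: ueqv_refl].
have [q qE] := Ud_of_equiv EP ER Einf; exists q; split.
- apply/Ud_coarserP => i j ij; apply/qE.
  have [[Bi Bj]|C] := pselect (B i /\ B j); first by right; auto.
  left; have [rij|[[a aN ia] [b bN jb]]] := HN i j ij.
    have H1 : ~ B i by move=> Bi; apply: C; split=> //; exact: Br Bi.
    split=> //; split=> // Bj; apply: H1; apply: Br Bj; exact: ueqv_sym.
  case: C; split; [exists a|exists b] => //; by rewrite leq_max ?aN ?bN.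
- apply/Ud_leP; exists d => i j ij.
  have hit k : B k -> exists2 a, a < d & ueqv q k a.
    move=> Bk; exists (h k) => //; apply/qE; right; split=> //.
    by split; [exact: Blt|exact: hlt].
  have [Bi|Bi] := pselect (B i).
    by right; split; apply: hit => //; exact: Br Bi.
  left; apply/qE; left; split=> //; split=> // Bj.
  by apply: Bi; apply: Br Bj; exact: ueqv_sym.
- apply/Ud_leP; exists M => i j /qE [[_ [_ ?]]|[Bi [Bj _]]]; first by left.
  by right.
- move=> i j id jd; rewrite qE; have [Si Sj] := (hlt i id, hlt j jd).
  split=> [[[]|[_ [_ H]]]|H]; first by move/(_ (Blt i id)).
    by apply: per_trans Si (per_trans SP H (per_sym SP Sj)).
  right; do 2!(split; first exact: Blt).
  exact: per_trans SP (per_sym SP Si) (per_trans SP H Sj).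
Qed.

Lemma amalgamate p r d S : Ud_le r p -> is_per S ->
  (forall i, i < d -> S i i) ->
  (forall i j, i < d -> j < d -> ueqv p i j -> S i j) ->
  exists q, [/\ coarser (sval q) (sval p), Ud_le q r, Ud_le r q &
    forall i j, i < d -> j < d -> ueqv q i j <-> S i j].
Proof.
(* For [d = 0] nothing is prescribed, and length one with the trace of [p] itself will do. *)
case: d => [|d] rp SP SR Sp; last exact: amalgamate_pos.
have [q [? ? ? _]] := amalgamate_pos (ltn0Sn 0) rp (ueqv_per p)
  (fun i _ => ueqv_refl p i) (fun _ _ _ _ H => H).
by exists q.
Qed.

(** The limit is the union of the increasing equivalences [ueqv (R n)]; it has
    infinitely many classes because [d n] is the least element of its class. *)
Lemma fusion (R : nat -> Ud) (d : nat -> nat) :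
  (forall n, d n < d n.+1) ->
  (forall n, coarser (sval (R n.+1)) (sval (R n))) ->
  (forall n i j, i <= d n -> j <= d n -> ueqv (R n.+1) i j -> ueqv (R n) i j) ->
  (forall n i, i < d n -> ~ ueqv (R n) (d n) i) ->
  exists q, forall n, coarser (sval q) (sval (R n)) /\
    forall i j, i <= d n -> j <= d n -> ueqv q i j <-> ueqv (R n) i j.
Proof.
move=> dS RS Ragree Rnew.
have dmono m n : m <= n -> d m <= d n.
  by move=> mn; apply: (homo_leq leqnn leq_trans) mn => k; exact: ltnW.
have dge n : n <= d n.
  by elim: n => // n IH; apply: leq_ltn_trans IH (dS n).
have Rmono m n i j : m <= n -> ueqv (R m) i j -> ueqv (R n) i j.
  elim: n => [|n IH]; first by rewrite leqn0 => /eqP ->.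
  rewrite leq_eqVlt => /predU1P[-> //|mn /(IH mn)].
  by have /Ud_coarserP := RS n; exact.
have Rdown m n i j : m <= n -> i <= d m -> j <= d m ->
    ueqv (R n) i j -> ueqv (R m) i j.
  elim: n => [|n IH]; first by rewrite leqn0 => /eqP ->.
  rewrite leq_eqVlt => /predU1P[-> //|mn im jm H]; apply: IH => //.
  by apply: Ragree H; apply: leq_trans (dmono m n mn).
pose E i j := exists n, ueqv (R n) i j.
(* The agreement includes [d n], so that its minimality in its class is inherited by the union. *)
have Eagree n i j : i <= d n -> j <= d n -> E i j -> ueqv (R n) i j.
  move=> id jd [m H]; have [mn|/ltnW nm] := leqP m n; first exact: Rmono H.
  exact: Rdown H.
have EP : is_per E.
  split=> [i j [n H]|i j k [m H] [n K]]; first by exists n; exact: ueqv_sym.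
  exists (maxn m n); apply: (@ueqv_trans _ _ j).
  - by apply: Rmono H; exact: leq_maxl.
  - by apply: Rmono K; exact: leq_maxr.
have [i|N|q qE] := @Ud_of_equiv E EP.
- by exists 0; exact: ueqv_refl.
- exists (d N) => a aN H; have ad := leq_trans aN (dge N).
  exact: Rnew ad (Eagree _ _ _ (leqnn _) (ltnW ad) H).
exists q => n; split; first by apply/Ud_coarserP => i j H; apply/qE; exists n.
by move=> i j id jd; rewrite qE; split=> [|H]; [exact: Eagree|exists n].
Qed.

(** The least number outside the classes that meet [{0, ..., N - 1}] is also the least element of
    its own class. *)
Lemma new_class p N : exists2 d, N <= d & forall i, i < d -> ~ ueqv p d i.
Proof.
have ex : exists i, `[< forall a, a < N -> ~ ueqv p i a >].
  by have [i Hi] := ueqv_inf p N; exists i; apply/asboolP.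
case: (ex_minnP ex) => d /asboolP dN dmin; exists d.
  by rewrite leqNgt; apply/negP => /dN; apply; exact: ueqv_refl.
move=> i id di; suff: d <= i by rewrite leqNgt id.
by apply: dmin; apply/asboolP => a aN ia; apply: (dN a aN); exact: ueqv_trans ia.
Qed.

(** Each [ps n] is replaced by an equivalent condition that is outright coarser than its predecessor
    and agrees with it up to and including a marker, the least element of a class. *)
Lemma Ud_sigma_closed : sigma_closed (le := Ud_order).
Proof.
move=> ps /= psS.
pose good n (st : Ud * nat) := [/\ Ud_le st.1 (ps n), Ud_le (ps n) st.1 &
  forall i, i < st.2 -> ~ ueqv st.1 st.2 i].
(* [good] is assumed under the existential so that [choice] applies to all pairs; the length
   [st.2.+1] below keeps the marker inside the prescribed trace. *)
have next n st : exists st', good n st -> [/\ good n.+1 st', st.2 < st'.2,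
    coarser (sval st'.1) (sval st.1) & forall i j, i <= st.2 -> j <= st.2 ->
    ueqv st'.1 i j -> ueqv st.1 i j].
  have [[le1 le2 H]|N] := pselect (good n st); last by exists st.
  have [] := @amalgamate st.1 (ps n.+1) st.2.+1 (ueqv st.1).
  - exact: Ud_le_trans (psS n) le2.
  - exact: ueqv_per.
  - by move=> i _; exact: ueqv_refl.
  - by [].
  move=> q [qp q1 q2 qa]; have [d dd Hd] := new_class q st.2.+1.
  exists (q, d) => _; split=> // i j id jd; exact: (qa _ _ _ _).1.
have {}next (nst : nat * (Ud * nat)) := next nst.1 nst.2.
have [f Hf] := choice next.
have [d0 _ Hd0] := new_class (ps 0) 0.
pose st := fix st n := if n is m.+1 then f (m, st m) else (ps 0, d0).
have Hst n : good n (st n).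
  elim: n => [|n IH]; first by split=> //; exact: Ud_le_refl.
  by have [] := Hf (n, st n) IH.
have step n := Hf (n, st n) (Hst n).
have [||||q Hq] := @fusion (fun n => (st n).1) (fun n => (st n).2).
- by move=> n; have [] := step n.
- by move=> n; have [] := step n.
- by move=> n; have [_ _ _] := step n.
- by move=> n; have [] := Hst n.
exists q => n; have [H _ _] := Hst n; apply: Ud_le_trans H.
exact: coarser_Ud_le (Hq n).1.
Qed.

End Ud.

(** * Meets of conditions and strictly coarser conditions *)

Section MeetUd.
Implicit Types (p q r : Ud) (X Y Z : set (set nat)) (E : nat -> nat -> Prop).

Lemma merge_mono N M E i j : N <= M -> merge N E i j -> merge M E i j.
Proof.
move=> NM [|[[a aN ia] [b bN jb]]]; first by left.
by right; split; [exists a|exists b] => //; apply: leq_trans NM.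
Qed.

Lemma inf_classes_merge p N : inf_classes (merge N (ueqv p)).
Proof.
move=> M; have [i Hi] := ueqv_inf p (maxn N M); exists i => a aM [ia|[[b bN ib] _]].
  by apply: Hi ia; rewrite leq_max aM orbT.
by apply: Hi ib; rewrite leq_max bN.
Qed.

(** A partition that is finer than [r] up to a finite merge has infinitely many blocks because [r]
    has, so it is a condition above [r]. *)
Lemma Ud_of_partition r X : partial_partition X -> pdom X = setT ->
  (exists N, forall i j, eqv X i j -> merge N (ueqv r) i j) ->
  exists q, sval q = X /\ Ud_le r q.
Proof.
move=> pX Xt [N HN]; have Xi : inf_partition X.
  split=> //; apply/inf_classesP => // M.
  have [i Hi] := inf_classes_merge r N M.
  by exists i => a aM /HN; exact: Hi.
exists (exist _ X Xi); split=> //; apply/Ud_leP; exists N; exact: HN.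
Qed.

(** [merge N (ueqv r)] is an equivalence relation, hence contains the one generated by [X] and [Y].
    A common lower bound [r] thus keeps the meet from collapsing to finitely many blocks. *)
Lemma meet_Ud r X Y N : partial_partition X -> disjoint_blocks Y ->
  pdom X = setT -> (forall i j, eqv X i j -> merge N (ueqv r) i j) ->
  (forall i j, eqv Y i j -> merge N (ueqv r) i j) ->
  exists q, is_meet (sval q) X Y /\ Ud_le r q.
Proof.
move=> pX dY Xt XN YN.
have [||q [qE rq]] := @Ud_of_partition r (meet X Y) (partial_partition_meet X Y).
- by rewrite pdom_meet Xt setTU.
- exists N => i j /eqv_meet; apply=> //; apply: merge_per; exact: ueqv_per.
exists q; rewrite qE; split=> //; apply: is_meet_meet => //; exact: pX.2.
Qed.

(** The density fact behind non-principality: gluing infinitely many pairs of classes cannot be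
    undone by a finite change. *)
Lemma strictly_coarser p r : Ud_le r p ->
  exists q, [/\ Ud_le q r, coarser (sval q) (sval p) & ~ Ud_le p q].
Proof.
move=> rp.
have [p' [p'p p'r _ _]] := amalgamate (d := 0) rp (ueqv_per p)
  (fun i _ => ueqv_refl p i) (fun _ _ _ _ H => H).
have {}p'p i j : ueqv p i j -> ueqv p' i j by move/Ud_coarserP: p'p; apply.
have /choice [nx Hnx] N : exists d, N <= d /\ forall i, i < d -> ~ ueqv p' d i.
  by have [d] := new_class p' N; exists d.
pose d := fix d n := if n is m.+1 then nx (d m).+1 else nx 0.
have dS n : d n < d n.+1 by have [] := Hnx (d n).+1.
have dnew n i : i < d n -> ~ ueqv p' (d n) i.
  by case: n => [|n]; [have [_] := Hnx 0|have [_] := Hnx (d n).+1]; exact.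
have dlt m n : m < n -> d m < d n.
  by move=> mn; apply: (homo_ltn ltn_trans) mn.
have dge n : n <= d n.
  by elim: n => // n IH; apply: leq_ltn_trans IH (dS n).
have dinj m n : ueqv p' (d m) (d n) -> m = n.
  case: (ltngtP m n) => // mn H; first by case: (dnew n _ (dlt _ _ mn)); exact: ueqv_sym.
  by case: (dnew m _ (dlt _ _ mn)).
(* Merge the classes of [d (2 n)] and [d (2 n + 1)] for every [n]. *)
pose E i j := ueqv p' i j \/
  exists m n, [/\ ueqv p' i (d m), ueqv p' j (d n) & m./2 = n./2].
have EP : is_per E.
  split=> [i j [H|[m [n [H K e]]]]|i j k].
  - by left; exact: ueqv_sym.
  - by right; exists n, m.
  move=> [H|[m [n [H K e]]]] [H'|[m' [n' [H' K' e']]]].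
  - by left; exact: ueqv_trans H'.
  - by right; exists m', n'; split=> //; exact: ueqv_trans H'.
  - by right; exists m, n; split=> //; apply: ueqv_trans K; exact: ueqv_sym.
  - right; exists m, n'; split=> //; rewrite e -e'; congr _./2.
    by apply: dinj; apply: ueqv_trans H'; exact: ueqv_sym.
have [i|N|q qE] := @Ud_of_equiv E EP.
- by left; exact: ueqv_refl.
- exists (d N.*2) => a aN.
  have ad k : N <= k -> a < d k.
    by move=> Nk; apply: leq_trans aN _; apply: leq_trans Nk (dge k).
  have N2 : N <= N.*2 by rewrite -addnn leq_addr.
  move=> [|[m [n [/dinj <- an]]]]; first exact/dnew/ad.
  rewrite doubleK => e; apply: (dnew n a _ (ueqv_sym an)); apply: ad.
  by rewrite e -{2}(odd_double_half n) -addnn addnA leq_addl.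
exists q; split.
- apply: Ud_le_trans p'r; apply: coarser_Ud_le; apply/Ud_coarserP => i j H.
  by apply/qE; left.
- by apply/Ud_coarserP => i j /p'p H; apply/qE; left.
move=> /Ud_leP [N HN].
(* This glued pair lies beyond the finite merge: [d N.*2] is the least element of its class and is
   at least [N]. *)
have : ueqv q (d N.*2) (d N.*2.+1).
  apply/qE; right; exists N.*2, N.*2.+1; split; try exact: ueqv_refl.
  by rewrite doubleK /= uphalf_double.
move=> /HN [/p'p /ueqv_sym|[[a aN /p'p H] _]]; first exact/dnew/dS.
apply: dnew H; apply: leq_trans aN _; apply: leq_trans (dge _).
by rewrite -addnn leq_addr.
Qed.

End MeetUd.

(** * The generic filter *)

Section Generic.
Implicit Types (p q r d : Ud) (x y z : name Ud) (X Y Z s t : set (set nat)).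

Local Notation le := Ud_order.
Local Notation "p ⊩ a" := (forces le p a%fm) (at level 100, a at level 200).
Local Notation "x ^" := (check Ud x) (at level 2, format "x ^").
Local Notation D := Ud_generic.

Lemma mem_genericI p x d :
  Ud_le p d -> (p ⊩ x ≐ (vfamily (sval d))^) -> (p ⊩ x ∈ D).
Proof.
move=> pd e; apply/forces_memE => q qp; exists q; first exact: fo_refl.
exists d; split; first exact: Ud_le_trans pd.
exact: forces_mono e.
Qed.

Lemma mem_genericD p x : (p ⊩ x ∈ D) ->
  exists d q, [/\ le q p, Ud_le q d & q ⊩ x ≐ (vfamily (sval d))^].
Proof.
by move/forces_memE/(_ p (fo_refl p)) => [q qp [d [qd e]]]; exists d, q.
Qed.

Lemma mem_genericE p x a : (p ⊩ x ∈ D) ->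
  (forall q d, le q p -> Ud_le q d -> (q ⊩ x ≐ (vfamily (sval d))^) ->
    (q ⊩ a)) -> (p ⊩ a).
Proof.
move=> H K; apply: forces_dense => q qp; weaken qp.
have [d [r [rq rd e]]] := mem_genericD H; exists r => //.
exact: K (fo_trans rq qp) rd e.
Qed.

Lemma generic_partitions p : p ⊩ ∀ x, x ∈ D ⇒ finf_partition omega x.
Proof.
apply: allI => x; fimp H; apply: (mem_genericE H) => r d _ _ e.
have K : r ⊩ finf_partition omega (vfamily (sval d))^.
  by apply: forces_inf_partition; case: d {e}.
by apply: feqvP K; feqv_solve.
Qed.

(** Below any condition stronger than [d] there is a [c] strictly coarser than [d], and [c] forces
    itself into the generic filter. *)
Lemma generic_nonprincipal p : p ⊩ fnonprincipal omega D.
Proof.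
apply: allI => x; fimp H; apply: (mem_genericE H) => r d _ rd e.
apply: forces_dense => r' r'r; weaken r'r.
have [c [cr cd ndc]] := strictly_coarser (Ud_le_trans r'r rd).
exists c => //; have {}e := forces_mono (cr : le c r') e.
apply: (@exI _ _ _ _ (vfamily (sval c))^).
have K : c ⊩ (vfamily (sval c))^ ∈ D
    ∧ fcoarser (vfamily (sval c))^ (vfamily (sval d))^
    ∧ ¬ feq_ae omega (vfamily (sval c))^ (vfamily (sval d))^.
  apply: andI; first exact: mem_genericI (Ud_le_refl _) (forces_eq_refl _ _).
  apply: andI; first exact/abs_coarser.
  apply: negI => u _ /andD [_ /andD [K _]]; apply: ndc.
  exact: (forces_coarser_ae Ud_sigma_closed K).
by apply: feqvP K; feqv_solve.
Qed.

Lemma generic_refinement p : p ⊩ frefinement_closed omega D.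
Proof.
apply: allI => x; apply: allI => y; fimp Hx; fimp Hy; fimp Hc.
apply: (mem_genericE Hx) => r d rq rd e; weaken rq.
apply: forces_dense => r' r'r; weaken r'r.
have [Hp _] := andD Hy; have [Hpp _] := andD Hp.
have [Y [s [sr pY eY]]] := no_new_partition Ud_sigma_closed Hpp.
exists s => //; weaken sr.
have {}Hp : s ⊩ fpartition omega (vfamily Y)^ by apply: feqvP Hp; feqv_solve.
have {}Hc : s ⊩ fcoarser (vfamily (sval d))^ (vfamily Y)^.
  by apply: feqvP Hc; feqv_solve.
have [_ Yt] := (abs_partition _ _).1 Hp.
have := (abs_coarser _ _ _).1 Hc => /coarserE => /(_ (@Ud_disjoint d) pY.2) C.
have sd : Ud_le s d by exact: Ud_le_trans r'r rd.
have [|d' [eY' dd']] := @Ud_of_partition d Y pY Yt.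
  by exists 0 => i j H; left; apply: C => //; rewrite Ud_pdom.
apply: (@mem_genericI _ _ d'); first exact: Ud_le_trans sd dd'.
by rewrite eY'.
Qed.

Lemma generic_finite_change p : p ⊩ ffinite_change_closed omega D.
Proof.
apply: allI => x; apply: allI => y; fimp Hx; fimp Hy.
apply: (mem_genericE Hx) => r d rq rd e; weaken rq.
apply: forces_dense => r' r'r; weaken r'r.
have [s [u [ur ps es]]] := no_new_partition Ud_sigma_closed (andD Hy).1.
exists u => //; weaken ur.
have {}Hy : u ⊩ ffin_partition omega (vfamily s)^ by apply: feqvP Hy; feqv_solve.
have [_ [k sk]] := (abs_fin_partition _ _).1 Hy.
(* The domain of [s] is [{0, ..., k - 1}], so merging up to [k] absorbs [s], and the meet stays
   above [d] in the order. *)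
have [i j|i j|d' [M dd']] := @meet_Ud d (sval d) s k
  (Ud_partial_partition d) ps.2 (Ud_pdom d).
- by left.
- move=> H; right; split; [exists i|exists j]; try exact: ueqv_refl.
    by have := eqv_dom H; rewrite sk.
  by have := eqv_dom (eqv_sym H); rewrite sk.
apply: (@exI _ _ _ _ (vfamily (sval d'))^).
have K : u ⊩ fis_meet omega (vfamily (sval d'))^ (vfamily (sval d))^ (vfamily s)^
   ∧ (vfamily (sval d'))^ ∈ D.
  apply: andI; first exact/(abs_is_meet Ud_sigma_closed).
  apply: (@mem_genericI _ _ d') (forces_eq_refl _ _).
  exact: Ud_le_trans r'r (Ud_le_trans rd dd').
by apply: feqvP K; feqv_solve.
Qed.

Lemma generic_directed p :
  p ⊩ ∀ x y, x ∈ D ⇒ y ∈ D ⇒ ∃ z, fis_meet omega z x y ∧ z ∈ D.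
Proof.
apply: allI => x; apply: allI => y; fimp Hx; fimp Hy.
apply: (mem_genericE Hx) => r d rq rd e; weaken rq.
apply: (mem_genericE Hy) => u c ur uc e'; weaken ur.
have ud : Ud_le u d by exact: Ud_le_trans ur rd.
move/Ud_leP: (ud) => [N HN]; move/Ud_leP: (uc) => [M HM].
have [i j H|i j H|d' [Me dd']] := @meet_Ud u (sval d) (sval c) (maxn N M)
  (Ud_partial_partition d) (@Ud_disjoint c) (Ud_pdom d).
- by apply: merge_mono (HN _ _ H); rewrite leq_maxl.
- by apply: merge_mono (HM _ _ H); rewrite leq_maxr.
apply: (@exI _ _ _ _ (vfamily (sval d'))^).
have K : u ⊩ fis_meet omega (vfamily (sval d'))^ (vfamily (sval d))^ (vfamily (sval c))^
   ∧ (vfamily (sval d'))^ ∈ D.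
  apply: andI; first exact/(abs_is_meet Ud_sigma_closed).
  exact: (@mem_genericI _ _ d') (forces_eq_refl _ _).
by apply: feqvP K; feqv_solve.
Qed.

End Generic.

(** * The game *)

Section Game.
Implicit Types (p q r c : Ud) (s t : set (set nat)).

Local Notation le := Ud_order.
Local Notation "p ⊩ a" := (forces le p a%fm) (at level 100, a at level 200).
Local Notation "x ^" := (check Ud x) (at level 2, format "x ^").
Local Notation D := Ud_generic.
Local Notation uname p := (vfamily (sval p))^.

(** [sigma] is only known to answer legally in complete runs.  So player I's
    moves are chosen before the legality of the previous answer [<t, p>] is
    known, and the move is legal in case that answer was. *)
Lemma move_exists p r t k : Ud_le r p -> exists q, Ud_le q r /\
  (segment (star t k) (sval p) -> partial_partition t -> pdom t = `I_k ->
   segment (star t k) (sval q) /\ coarser (sval q) (sval p)).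
Proof.
move=> rp; have [q [qp qr _ qE]] := amalgamate (d := k.+1) rp (ueqv_per p)
  (fun i _ => ueqv_refl p i) (fun _ _ _ _ H => H).
exists q; split=> // tp pt tk; split=> //; move: tp.
have ps := partial_partition_star pt tk; have sk := pdom_star tk.
rewrite !(segmentE ps sk); try exact: Ud_partial_partition; try exact: Ud_pdom.
by move=> H i j ik jk; rewrite (H i j ik jk) -/(ueqv q i j) qE.
Qed.

Section Strategy.
Variables (sigma : name Ud) (q0 : Ud).

Definition history (h : seq Ud) : name Ud :=
  graph `I_(size h) (fun i => uname (nth q0 h i)).

Lemma forces_history p h : (forall i, i < size h -> Ud_le p (nth q0 h i)) ->
  p ⊩ ffun_from_to (history h) (fun j => j ∈ (vnat (size h))^)%fm
    (fun z => z ∈ D)%fm.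
Proof.
move=> H; have e := vnatE p (size h) (le := le).
have K : p ⊩ ffun_from_to (history h)
    (fun j => j ∈ (vset_of vnat `I_(size h))^)%fm (fun z => z ∈ D)%fm.
  apply: forces_function => [|n ns]; first by fcongr_solve.
  by apply: mem_genericI (H n ns) _; exact: forces_eq_refl.
by apply: feqvP K; feqv_solve.
Qed.

(** The answer is a name for a pair. An extension makes it a ground model pair: the first component
    because no partitions are added, the second because elements of the generic filter are
    conditions. *)
Lemma strategy_answer p h : 0 < size h ->
  (forall i, i < size h -> Ud_le p (nth q0 h i)) ->
  (p ⊩ fstrategyII omega D sigma) ->
  exists r t k u, [/\ Ud_le r p, partial_partition t, pdom t = `I_k, Ud_le r u &
    r ⊩ fgraph sigma (history h) (opair (vfamily t)^ (uname u))].
Proof.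
move=> h0 hp strat; have [_ /andD [tot _]] := andD strat.
have dom : p ⊩ ∃ n i, n ∈ omega ∧ fis_succ i n ∧
    ffun_from_to (history h) (fun j => j ∈ i)%fm (fun z => z ∈ D)%fm.
  apply: (@exI _ _ _ _ (vnat (size h).-1)^).
  apply: (@exI _ _ _ _ (vnat (size h))^).
  apply: andI; first exact: mem_omega.
  apply: andI; last exact: forces_history.
  by apply/abs_is_succ; rewrite prednK.
have K := impE (allE _ tot) dom; fex K v.
have [||_ T] := fgraph_type _ _ strat K; try by fcongr_solve.
fex T t'; fex T y; have [/is_pairE ev /andD [Ht Hy]] := andD T.
have [t [r [rq pt et]]] := no_new_partition Ud_sigma_closed (andD Ht).1.
weaken rq; have [u [r' [r'r r'u eu]]] := mem_genericD Hy; weaken r'r.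
have {}Ht : r' ⊩ ffin_partition omega (vfamily t)^ by apply: feqvP Ht; feqv_solve.
have [_ [k tk]] := (abs_fin_partition _ _).1 Ht.
exists r', t, k, u; split=> //.
have e2 := forces_eq_trans ev (opair_congr et eu).
by apply: feqvP K; feqv_solve.
Qed.

(** [pos_cond] is a condition that has decided player II's latest answer, the pair of [pos_part] and
    [pos_last]; [pos_size] is the domain of [pos_part]. *)
Record position := Position {
  pos_hist : seq Ud;
  pos_cond : Ud;
  pos_part : set (set nat);
  pos_size : nat;
  pos_last : Ud }.

Definition decided (st : position) := let: Position h r t k u := st in
  [/\ 0 < size h, forall i, i < size h -> Ud_le r (nth q0 h i),
      partial_partition t /\ pdom t = `I_k, Ud_le r q0 /\ Ud_le r u &
      r ⊩ fgraph sigma (history h) (opair (vfamily t)^ (uname u))].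

Definition next_position (st st' : position) :=
  let: Position h r t k u := st in let: Position h' r' _ _ _ := st' in
  exists2 x, h' = rcons h x & [/\ Ud_le x r, Ud_le r' x &
    segment (star t k) (sval u) ->
    segment (star t k) (sval x) /\ coarser (sval x) (sval u)].

(** Stated for every position so that [choice] yields a function to iterate; positions that are not
    [decided] are returned unchanged. *)
Lemma next_exists : (q0 ⊩ fstrategyII omega D sigma) -> forall st,
  exists st', decided st -> decided st' /\ next_position st st'.
Proof.
move=> strat st; have [|N] := pselect (decided st); last by exists st.
case: st => h r t k u; move=> [h0 hr [pt tk] [rq ru] ans].
have [x [xr xP]] := move_exists t k ru.
have xq : Ud_le x q0 := Ud_le_trans xr rq.
have hx i : i < size (rcons h x) -> Ud_le x (nth q0 (rcons h x) i).
  rewrite size_rcons nth_rcons ltnS leq_eqVlt.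
  case: ltngtP => //= [ih _|_ _]; last exact: Ud_le_refl.
  exact: Ud_le_trans xr (hr i ih).
have [|r' [t' [k' [u' [r'x pt' tk' r'u' ans']]]]] :=
  strategy_answer _ hx (forces_mono (xq : le x q0) strat).
  by rewrite size_rcons.
exists (Position (rcons h x) r' t' k' u') => _; split; last first.
  by exists x => //; split=> // /xP; exact.
split=> //; first by rewrite size_rcons.
- by move=> i /hx; exact: Ud_le_trans.
- by split=> //; exact: Ud_le_trans xq.
Qed.

End Strategy.

(** * The run as names, and its legality in the ground model *)

Section Run.
Variables (x y : nat -> Ud) (t : nat -> set (set nat)) (k : nat -> nat).
Variables (s : set (set nat)) (d : Ud).

Definition x_name : name Ud := graph setT (fun n => uname (x n)).
Definition y_name : name Ud := graph setT (fun n => uname (y n)).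
Definition t_name : name Ud := graph setT (fun n => (vfamily (t n))^).

Hypothesis t_fin : forall n, partial_partition (t n) /\ pdom (t n) = `I_(k n).

Definition ground_legalI n := if n is m.+1
  then segment (star (t m) (k m)) (sval (x n)) /\ coarser (sval (x n)) (sval (y m))
  else segment s (sval (x 0)) /\ coarser (sval (x 0)) (sval d).

Lemma Ud_inf p : inf_partition (sval p). Proof. by case: p. Qed.

Lemma forces_legalI c n : ground_legalI n ->
  c ⊩ flegalI omega (vfamily s)^ (uname d) x_name t_name y_name (vnat n)^.
Proof.
move=> H; apply: andI.
  fimp K; move/abs_empty: K H => -> H; apply: (fatI (n := 0)) => //.
  by apply/(fellentuckE _ _ _ (Ud_inf _)).
apply: allI => m'; fimp Hm; fimp Hn; apply: (memE Hm) => r m rq _ e; weaken rq.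
have {}Hn : r ⊩ fis_succ (vnat n)^ (vnat m)^ by apply: feqvP Hn; feqv_solve.
move/abs_is_succ: Hn H => -> [H1 H2].
have K : r ⊩ fat x_name (vnat m.+1)^ (fun xn => fat t_name (vnat m)^ (fun tm =>
    fat y_name (vnat m)^ (fun ym => fstar tm (fun tm' =>
    fellentuck omega tm' ym xn)))).
  apply: fatI => //; apply: fatI => //; apply: fatI => //.
  apply: fstarI (t_fin m).2 _.
  by apply/(fellentuckE _ _ _ (Ud_inf _)).
by apply: feqvP K; feqv_solve.
Qed.

Definition ground_legalII n :=
  segment (star (t n) (k n)) (sval (y n)) /\ forall m, n = m.+1 ->
  [/\ segment (star (t m) (k m)) (sval (y n)), coarser (sval (y n)) (sval (x n)),
      segment (star (t m) (k m)) (star (t n) (k n)) &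
      exists2 j, t m #= `I_j & t n #= `I_j.+1].

(** Legality concerns ground model objects only. What one condition forces about it is therefore
    true, and may be used at conditions unrelated to [c]. *)
Lemma legalII_ground c n :
  (c ⊩ flegalII omega (vfamily s)^ x_name t_name y_name (vnat n)^) ->
  ground_legalII n.
Proof.
move=> H; have {}H := fatD H ltac:(fcongr_solve).
have {}H := fatD H ltac:(fcongr_solve).
have {}H := fatD H ltac:(fcongr_solve).
have {}H := fstarD (t_fin n).2 H ltac:(fcongr_solve).
have [/abs_segment H1 /andD [_ H2]] := andD H; split=> // m nm.
have {}nm : c ⊩ fis_succ (vnat n)^ (vnat m)^ by apply/abs_is_succ.
have mw : c ⊩ (vnat m)^ ∈ omega by exact: mem_omega.
have {}H2 := impE (impE (allE _ H2) mw) nm.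
have {}H2 := fatD H2 ltac:(fcongr_solve).
have {}H2 := fstarD (t_fin m).2 H2 ltac:(fcongr_solve).
have [/(fellentuckE _ _ _ (Ud_inf _)) [K1 K2] /andD [/abs_segment K3 K4]] := andD H2.
by split=> //; exact: succ_size_card K4.
Qed.


End Run.

(** If the domains were equal, [star t k] would be an initial segment of [star t' k'] with the same
    domain, so [t = t'] against the sizes. The strict growth makes the domains usable as markers in
    [fusion]. *)
Lemma size_lt t k t' k' j : partial_partition t -> pdom t = `I_k ->
  partial_partition t' -> pdom t' = `I_k' ->
  segment (star t k) (star t' k') -> t #= `I_j -> t' #= `I_j.+1 -> k < k'.
Proof.
move=> pt tk pt' tk' seg tj tj'.
have dom n : pdom (star t k) n <-> n < k.+1 by rewrite (pdom_star tk).
have dom' n : pdom (star t' k') n <-> n < k'.+1 by rewrite (pdom_star tk').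
have k_le : k <= k'.
  have [|c tc /(_ k)[/(_ erefl) [ck _] _]] := seg [set k]; first by right.
  by rewrite -ltnS; apply/dom'; exists c.
rewrite ltn_neqAle k_le andbT; apply/eqP => kk'; rewrite -kk' in tk' seg dom'.
have ps' := partial_partition_star pt' tk'.
have E i l : eqv (star t k) i l <-> eqv (star t' k) i l.
  split=> [[b tb [bi bl]]|[c tc [ci cl]]].
    have [c tc bc] := seg b tb; exists c => //.
    by have [[? _] [? _]] := ((bc i).1 bi, (bc l).1 bl).
  have ik : i < k.+1 by apply/dom'; exists c.
  have lk : l < k.+1 by apply/dom'; exists c.
  have [b tb bi] := (dom i).2 ik; have [c' tc' bc'] := seg b tb.
  have [c'i _] := (bc' i).1 bi.
  have cc' : c = c' by apply: ps'.2 => //; exact: setI_neq0 ci c'i.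
  exists b => //; split=> //; apply/bc'; split; first by rewrite -cc'.
  exact/dom.
have sub u u' i l : pdom u = `I_k ->
    (eqv (star u k) i l -> eqv (star u' k) i l) -> eqv u i l -> eqv u' i l.
  move=> uk H K; have [|//|[ik _]] := (eqv_star u' k i l).1 _.
    by apply: H; apply/eqv_star; left.
  by have := eqv_dom K; rewrite uk ik /= ltnn.
have tt' : t = t'.
  by apply: eq_blocks => // i l; split; apply: sub => // /E.
have : `I_j #= `I_j.+1 by apply: card_eq_trans (card_esym tj) _; rewrite tt'.
by move/card_eq_II/n_Sn.
Qed.

Lemma play_exists sigma q0 x0 : (q0 ⊩ fstrategyII omega D sigma) -> Ud_le x0 q0 ->
  exists (x y r : nat -> Ud) (t : nat -> set (set nat)) (k : nat -> nat),
  [/\ x 0 = x0,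
      forall n, partial_partition (t n) /\ pdom (t n) = `I_(k n),
      forall n, [/\ Ud_le (r n) q0, Ud_le (r n) (x n), Ud_le (r n) (y n) &
        Ud_le (x n.+1) (r n)],
      forall n, segment (star (t n) (k n)) (sval (y n)) ->
        segment (star (t n) (k n)) (sval (x n.+1)) /\
        coarser (sval (x n.+1)) (sval (y n)) &
      forall n, exists h, [/\ size h = n.+1, forall i, i < size h -> nth q0 h i = x i &
        r n ⊩ fgraph sigma (history q0 h) (opair (vfamily (t n))^ (uname (y n)))]].
Proof.
move=> strat xq.
have [f Hf] := choice (next_exists strat).
have h0 i : i < size [:: x0] -> Ud_le x0 (nth q0 [:: x0] i).
  by case: i => // _; exact: Ud_le_refl.
have [r0 [t0 [k0 [u0 [rx pt tk ru ans]]]]] :=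
  strategy_answer (isT : 0 < size [:: x0]) h0 (forces_mono (xq : le x0 q0) strat).
pose st n := iter n f (Position [:: x0] r0 t0 k0 u0).
have dec n : decided sigma q0 (st n).
  elim: n => [|n IH]; last by have [] := Hf (st n) IH.
  split=> //; last by split=> //; exact: Ud_le_trans xq.
  by case=> // _; exact: rx.
have next n : next_position (st n) (st n.+1) by have [] := Hf (st n) (dec n).
pose h n := pos_hist (st n).
(* Histories grow by one entry per round, so this last entry of the [n]-th history is player I's
   [n]-th move. *)
pose x n := nth q0 (h n) n.
have next_h n : h n.+1 = rcons (h n) (last q0 (h n.+1)).
  have := next n; rewrite /h.
  by case: (st n) (st n.+1) => ? ? ? ? ? [? ? ? ? ?] /= [z -> _]; rewrite last_rcons.
have size_h n : size (h n) = n.+1.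
  by elim: n => // n IH; rewrite next_h size_rcons IH.
have nth_h n i : i < size (h n) -> nth q0 (h n) i = x i.
  elim: n => [|n IH]; first by case: i.
  rewrite size_h ltnS leq_eqVlt => /predU1P[-> //|iS].
  by rewrite next_h nth_rcons size_h iS; apply: IH; rewrite size_h.
have last_h n : last q0 (h n) = x n by rewrite -nth_last size_h.
exists x, (fun n => pos_last (st n)), (fun n => pos_cond (st n)),
  (fun n => pos_part (st n)), (fun n => pos_size (st n)).
split=> // n.
- by have := dec n; case: (st n) => ? ? ? ? ? [].
- have xn := nth_h n n.
  move: (dec n) (next n) xn (last_h n.+1) (size_h n); rewrite /h.
  case: (st n) (st n.+1) => ? ? ? ? ? [? ? ? ? ?] /=.
  move=> [? hr _ [? ?] _] [z -> [zr _ _]] xn.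
  rewrite last_rcons => <- hn; split=> //; rewrite -xn ?hn //; apply: hr; by rewrite hn.
- move: (next n) (last_h n.+1); rewrite /h.
  case: (st n) (st n.+1) => ? ? ? ? ? [? ? ? ? ?] /= [z -> [_ _ K]].
  by rewrite last_rcons => <-.
- exists (h n); split=> //; first exact: nth_h.
  by have := dec n; rewrite /h; case: (st n) => ? ? ? ? ? [].
Qed.

Lemma no_winning_strategy q0 sigma s j d : partial_partition s ->
  pdom s = `I_j -> coarser s (sval d) -> Ud_le q0 d ->
  (q0 ⊩ fwinningII omega D (vfamily s)^ (uname d) sigma) -> False.
Proof.
move=> ps sj sd qd /andD [strat win].
(* The first move must have [s] as an initial segment and be coarser than [d]; as [s] is coarser
   than [d], its relation is an admissible trace for amalgamation. *)
have [x0 [x0d x0q _ x0s]] : exists q, [/\ coarser (sval q) (sval d), Ud_le q q0,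
    Ud_le q0 q & forall i l, i < j -> l < j -> ueqv q i l <-> eqv s i l].
  apply: amalgamate => //; first exact: eqv_per ps.2.
    by move=> i ij; apply/eqv_refl; rewrite sj.
  move=> i l ij lj H; apply: (coarserE ps.2 (@Ud_disjoint d)).1 => //; by rewrite sj.
have [x [y [r [t [k [x0E t_fin rP good hist]]]]]] := play_exists strat x0q.
pose X := x_name x; pose Y := y_name y; pose T := t_name t.
(* The winning property for this particular run. It is available at every lower bound of the [r n],
   since [r n] has decided the [n]-th answer, and is applied at two such bounds, [c] and [q]. *)
have run c : (forall n, Ud_le c (r n)) ->
  (c ⊩ (∀ n, n ∈ omega ⇒
      (∀ m, (m ∈ n ∨ m ≐ n) ⇒ flegalI omega (vfamily s)^ (uname d) X T Y m) ⇒
       flegalII omega (vfamily s)^ X T Y n) ∧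
    ((∀ n, n ∈ omega ⇒ flegalI omega (vfamily s)^ (uname d) X T Y n) ⇒
      ¬ fI_wins omega D T)).
  move=> cr; have cq : le c q0.
    by have [H _ _ _] := rP 0; exact: Ud_le_trans (cr 0) H.
  have W := allE Y (allE T (allE X (forces_mono cq win))).
  have HX : c ⊩ ffun_from_to X (fun n => n ∈ omega) (fun z => z ∈ D).
    apply: forces_function => [|n _]; first by fcongr_solve.
    have [_ H _ _] := rP n.
    exact: (mem_genericI (Ud_le_trans (cr n) H) (forces_eq_refl _ _)).
  have HT : c ⊩ ffun_from_to T (fun n => n ∈ omega) (fun u => ffin_partition omega u).
    apply: forces_function => [|n _]; first by fcongr_solve.
    by apply/abs_fin_partition; have [? ?] := t_fin n; split=> //; exists (k n).
  have HY : c ⊩ ffun_from_to Y (fun n => n ∈ omega) (fun z => z ∈ D).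
    apply: forces_function => [|n _]; first by fcongr_solve.
    have [_ _ H _] := rP n.
    exact: (mem_genericI (Ud_le_trans (cr n) H) (forces_eq_refl _ _)).
  apply: (impE (impE (impE (impE W HX) HT) HY)).
  apply: allI => n'; fimp Hn; apply: (memE Hn) => u n uq _ e; weaken uq.
  have {cr} ur : Ud_le u (r n) by exact: Ud_le_trans Hq (cr n).
  have [h [sh hx ans]] := hist n; have {}ans := forces_mono (ur : le u (r n)) ans.
  have K : u ⊩ ffollows D sigma X T Y (vnat n)^.
    apply: (@exI _ _ _ _ (vnat n.+1)^); apply: (@exI _ _ _ _ (history q0 h)).
    apply: (@exI _ _ _ _ (opair (vfamily (t n))^ (uname (y n)))).
    apply: andI; first exact/abs_is_succ.
    apply: andI.
      rewrite -sh; apply: forces_history => i ih; rewrite hx //.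
      have rx m l : m <= l -> Ud_le (r l) (x m).
        elim: l => [|l IH]; first by rewrite leqn0 => /eqP ->; have [] := rP 0.
        rewrite leq_eqVlt => /predU1P[->|/IH]; first by have [] := rP l.+1.
        have [_ rx _ _] := rP l.+1; have [_ _ _ xr] := rP l.
        by apply: Ud_le_trans; exact: Ud_le_trans xr.
      by apply: Ud_le_trans ur _; apply: rx; rewrite -ltnS -sh.
    apply: andI; first by apply: graph_sub => // i ih; rewrite hx.
    apply: andI => //; apply: fatI => //; apply: fatI => //.
    exact/is_pairE/forces_eq_refl.
  by apply: feqvP K; feqv_solve.
have rdec n : Ud_le (r n.+1) (r n).
  have [_ H _ _] := rP n.+1; have [_ _ _ K] := rP n; exact: Ud_le_trans K.
(* A lower bound of the conditions [r n] shows that the run is legal; only then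
   does [fusion] yield a partition that player I wins with. *)
have [c cr] := Ud_sigma_closed rdec.
(* The answer in round [n] is legal once player I's moves up to [n] are, and these are legal as soon
   as the answers before round [n] are: hence strong induction. *)
have legal n : ground_legalII x y t k n.
  elim/ltn_ind: n => n IH.
  have legI i : i <= n -> ground_legalI x y t k s d i.
    case: i => [_|i /IH [/good]//]; rewrite /ground_legalI x0E; split=> //.
    apply/(segmentE ps sj (Ud_partial_partition _) (Ud_pdom _)) => i l ij lj.
    by apply: iff_sym; exact: x0s.
  apply: (@legalII_ground x y t k s t_fin c); have [W _] := andD (run c cr).
  have nw : c ⊩ (vnat n)^ ∈ omega by exact: mem_omega.
  apply: impE (impE (allE _ W) nw) _; apply: allI => m; fimp Hm.
  have mem_n i u : i <= n -> (u ⊩ m ≐ (vnat i)^) ->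
      (u ⊩ flegalI omega (vfamily s)^ (uname d) X T Y m).
    move=> i_n e; have K : u ⊩ flegalI omega (vfamily s)^ (uname d) X T Y (vnat i)^.
      by apply: forces_legalI => //; exact: legI.
    by apply: feqvP K; feqv_solve.
  fcase Hm; last exact: mem_n (leqnn n) Hm.
  move/mem_vnat: Hm => Hm; apply: (memE Hm) => u i uq /= /ltnW ij e.
  exact: mem_n ij e.
have seg n : forall i l, i <= k n -> l <= k n ->
    eqv (star (t n) (k n)) i l <-> ueqv (y n) i l.
  have [pt tk] := t_fin n; have [sy _] := legal n.
  by apply/(segmentE (partial_partition_star pt tk) (pdom_star tk)
    (Ud_partial_partition _) (Ud_pdom _)).
have segS n : forall i l, i <= k n -> l <= k n ->
    eqv (star (t n) (k n)) i l <-> ueqv (y n.+1) i l.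
  have [pt tk] := t_fin n; have [_ /(_ n erefl) [sy _ _ _]] := legal n.+1.
  by apply/(segmentE (partial_partition_star pt tk) (pdom_star tk)
    (Ud_partial_partition _) (Ud_pdom _)).
(* The markers are the domains [k n]: both [y n] and [y n.+1] have [star (t n) (k n)] as initial
   segment, so they agree up to [k n], and its block [{k n}] makes [k n] the least element of its
   class in [y n]. *)
have [n|n|n i l ik lk H|n i ik|q qP] := @fusion y k.
- have [_ /(_ n erefl) [_ _ st [m tm tSm]]] := legal n.+1.
  have [pt tk] := t_fin n; have [pt' tk'] := t_fin n.+1.
  exact: size_lt st tm tSm.
- have [_ /(_ n erefl) [_ /Ud_coarserP yx _ _]] := legal n.+1.
  have [/good [_ /Ud_coarserP xy] _] := legal n.
  by apply/Ud_coarserP => i l /xy /yx.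
- by apply/seg => //; apply/segS.
- move=> /(seg n _ _ (leqnn _) (ltnW ik)) /eqv_star [/eqv_dom|[_ e]].
    by have [_ ->] := t_fin n; rewrite /= ltnn.
  by rewrite e ltnn in ik.
(* The fusion was taken along the [y n]; it falls below [r n] because [y n.+1] is coarser than
   [x n.+1], which is below [r n]. *)
have qr n : Ud_le q (r n).
  have [_ _ _ xr] := rP n; apply: Ud_le_trans xr.
  apply: Ud_le_trans (coarser_Ud_le (qP n.+1).1) _.
  by have [_ /(_ n erefl) [_ /coarser_Ud_le]] := legal n.+1.
have [_ W] := andD (run q qr).
have all_legal : q ⊩ ∀ n, n ∈ omega ⇒ flegalI omega (vfamily s)^ (uname d) X T Y n.
  apply: allI => n'; fimp Hn; apply: (memE Hn) => u n uq _ e.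
  have K : u ⊩ flegalI omega (vfamily s)^ (uname d) X T Y (vnat n)^.
    apply: forces_legalI => //; case: n {e} => [|n].
      rewrite /ground_legalI x0E; split=> //.
      apply/(segmentE ps sj (Ud_partial_partition _) (Ud_pdom _)) => i l ij lj.
      by apply: iff_sym; exact: x0s.
    by have [/good] := legal n.
  by apply: feqvP K; feqv_solve.
apply: negD (impE W all_legal) _.
apply: (@exI _ _ _ _ (uname q)); apply: andI.
  by apply/abs_partition; split; [exact: Ud_partial_partition|exact: Ud_pdom].
apply: andI; last exact: (mem_genericI (Ud_le_refl q) (forces_eq_refl _ _)).
apply: allI => n'; fimp Hn; apply: (memE Hn) => u n uq _ e.
have K : u ⊩ fat T (vnat n)^ (fun tn => fsegment tn (uname q)).
  apply: fatI => //; apply/abs_segment; have [pt tk] := t_fin n.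
  apply/(segmentE pt tk (Ud_partial_partition _) (Ud_pdom _)) => i l ik lk.
  have qy := (qP n).2 i l (ltnW ik) (ltnW lk).
  apply: iff_trans (iff_sym qy); apply: iff_trans (seg n i l (ltnW ik) (ltnW lk)).
  rewrite eqv_star; by split=> [|[//|[e']]]; [left|rewrite e' ltnn in ik].
by apply: feqvP K; feqv_solve.
Qed.

Lemma generic_game p : p ⊩ ∀ z x, x ∈ D ⇒ ffin_partition omega z ⇒ fcoarser z x ⇒
  ¬ ∃ sigma, fwinningII omega D z x sigma.
Proof.
apply: allI => s'; apply: allI => x; fimp Hx; fimp Hs; fimp Hc.
apply: negI => u uq H; weaken uq; fex H sigma.
have [d [r [rq rd ed]]] := mem_genericD Hx; weaken rq.
have [s [v [vr ps es]]] := no_new_partition Ud_sigma_closed (andD Hs).1; weaken vr.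
have {}Hs : v ⊩ ffin_partition omega (vfamily s)^ by apply: feqvP Hs; feqv_solve.
have {}Hc : v ⊩ fcoarser (vfamily s)^ (uname d) by apply: feqvP Hc; feqv_solve.
have {}H : v ⊩ fwinningII omega D (vfamily s)^ (uname d) sigma.
  by apply: feqvP H; feqv_solve.
have [_ [j sj]] := (abs_fin_partition _ _).1 Hs.
have sd : coarser s (sval d) by exact: (abs_coarser _ _ _).1 Hc.
exact: (no_winning_strategy ps sj sd (Ud_le_trans vr rd) H).
Qed.

End Game.

Theorem theorem5p1 : forall p : Ud, forces Ud_le p (fgame_filter Ud_generic).
Proof.
move=> p; change (forces Ud_order p (fgame_filter Ud_generic)).
apply: (@exI _ _ _ _ omega); apply: andI; first exact: forces_is_omega.
apply: andI; last exact: generic_directed.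
apply: andI; first exact: generic_partitions.
apply: andI; first exact: generic_nonprincipal.
apply: andI; first exact: generic_refinement.
apply: andI; first exact: generic_finite_change.
exact: generic_game.
Qed.
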